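(* Let $\Omega$ be a locally compact (Hausdorff) space and let $C_0(\Omega)$ be the Banach space of continuous scalar functions on $\Omega$ vanishing at infinity, with the supremum norm. Then for every Banach space $Y$ and every bounded linear operator $T\colon C_0(\Omega)\to Y$, $$\omega(T^* )\leq\pi\operatorname{uc}(T).$$ If $C_0(\Omega)$ consists of real functions (real scalars), then $\omega(T^* )\leq 2\operatorname{uc}(T)$. In particular $C_0(\Omega)$ has the properties $\mathrm{(V)}_q$ and $\mathrm{(V)}_q^{\omega^*}$.
   Context: For a bounded sequence $(y_n)$ in a Banach space, $\operatorname{ca}((y_n))=\inf_{n\in\mathbb N}\sup\{\|y_k-y_l\|: k,l\geq n\}$. For a bounded linear operator $T\colon X\to Y$, $$\operatorname{uc}(T)=\sup\Big\{\operatorname{ca}\Big(\big(\textstyle\sum_{i=1}^n Tx_i\big)_n\Big):\ (x_n)\subset X,\ \sup_{x^*\in B_{X^*}}\sum_{n=1}^\infty|x^*(x_n)|\leq 1\Big\}.$$ For a bounded subset $A$ of a Banach space $E$, $\omega(A)=\inf\{\sup_{a\in A}\operatorname{dist}(a,K): \emptyset\neq K\subset E \text{ weakly compact}\}$, and $\gamma(A)=\sup\{|\lim_n\lim_m x^*_m(x_n)-\lim_m\lim_n x^*_m(x_n)|\}$ over sequences $(x_n)\subset A$, $(x_m^* )\subset B_{E^*}$ for which the iterated limits exist. For $T\colon X\to Y$: $\gamma(T)=\gamma(T(B_X))$, $\omega(T^* )=\omega(T^*(B_{Y^*}))$ (in $X^*$). A Banach space $X$ has $\mathrm{(V)}_q$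 if there is $C>0$ with $\gamma(T)\le C\operatorname{uc}(T)$ for every Banach space $Y$ and every operator $T\colon X\to Y$; it has $\mathrm{(V)}_q^{\omega^*}$ if there is $C>0$ with $\omega(T^* )\le C\operatorname{uc}(T)$ for all such $Y,T$. *)

(* Defs.v *)
From HB Require Import structures.
From mathcomp Require Import all_boot all_order all_algebra.
From mathcomp Require Import all_classical all_reals all_analysis.
From mathcomp Require Import complex.
Set Implicit Arguments. Unset Strict Implicit. Unset Printing Implicit Defensive.
Import Order.TTheory GRing.Theory Num.Theory.
Local Open Scope ring_scope.
Local Open Scope classical_set_scope.

(* Scalars: an arbitrary numFieldType K (used with K = R and K = R[i]). *)
(* The space X = C_0(Omega; K) is represented by the functions          *)
(* Omega -> K satisfying [C0]; vector operations are pointwise and the  *)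
(* norm is the sup norm, accessed through "||f||_oo <= s".              *)

Section C0.
Variables (K : numFieldType) (Omega : topologicalType).

Definition scont (f : Omega -> K) : Prop :=
  forall (w : Omega) (e : K), 0 < e -> \forall z \near w, `|f z - f w| < e.

Definition vanish_at_infty (f : Omega -> K) : Prop :=
  forall e : K, 0 < e -> compact [set w | e <= `|f w|].

Definition C0 (f : Omega -> K) : Prop := scont f /\ vanish_at_infty f.

Definition supnorm_le (f : Omega -> K) (s : K) : Prop :=
  0 <= s /\ forall w, `|f w| <= s.

Definition lin_on_C0 (phi : (Omega -> K) -> K) : Prop :=
  forall (a : K) f g, C0 f -> C0 g ->
    phi (fun w => a * f w + g w) = a * phi f + phi g.

Definition dnorm_le (phi : (Omega -> K) -> K) (s : K) : Prop :=
  forall f t, C0 f -> supnorm_le f t -> `|phi f| <= s * t.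

Definition is_dual (phi : (Omega -> K) -> K) : Prop :=
  lin_on_C0 phi /\ exists s, dnorm_le phi s.

Definition is_bidual (Phi : ((Omega -> K) -> K) -> K) : Prop :=
  (forall (a : K) phi psi, is_dual phi -> is_dual psi ->
     Phi (fun f => a * phi f + psi f) = a * Phi phi + Phi psi) /\
  exists C : K, forall phi s, is_dual phi -> 0 <= s -> dnorm_le phi s ->
     `|Phi phi| <= C * s.

Definition wopen (U : set ((Omega -> K) -> K)) : Prop :=
  forall phi, U phi -> is_dual phi ->
    exists (n : nat) (Phi : 'I_n -> ((Omega -> K) -> K) -> K) (e : K),
      [/\ 0 < e, (forall i, is_bidual (Phi i)) &
          forall psi, is_dual psi ->
            (forall i, `|Phi i psi - Phi i phi| < e) -> U psi].

Definition wcompact (Ks : set ((Omega -> K) -> K)) : Prop :=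
  (forall phi, Ks phi -> is_dual phi) /\
  forall (I : Type) (U : I -> set ((Omega -> K) -> K)),
    (forall i, wopen (U i)) ->
    (forall phi, Ks phi -> exists i, U i phi) ->
    exists (n : nat) (h : 'I_n -> I), forall phi, Ks phi -> exists j, U (h j) phi.

(* omega(A) <= d   where omega(A) = inf_{K weakly compact, nonempty}
   sup_{a in A} dist(a, K) *)
Definition omega_le (A : set ((Omega -> K) -> K)) (d : K) : Prop :=
  forall e : K, 0 < e ->
    exists Ks : set ((Omega -> K) -> K),
      [/\ Ks !=set0, wcompact Ks &
          forall a, A a -> exists2 k, Ks k & dnorm_le (fun f => a f - k f) (d + e)].

Section Op.
Variable (Y : normedModType K).

Definition bounded_op (T : (Omega -> K) -> Y) : Prop :=
  (forall (a : K) f g, C0 f -> C0 g ->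
     T (fun w => a * f w + g w) = a *: T f + T g) /\
  exists M : K, forall f s, C0 f -> supnorm_le f s -> `|T f| <= M * s.

Definition Ydual_ball (g : Y -> K) : Prop :=
  (forall (a : K) y z, g (a *: y + z) = a * g y + g z) /\
  forall y, `|g y| <= `|y|.

Definition adj_ball_image (T : (Omega -> K) -> Y) : set ((Omega -> K) -> K) :=
  [set phi | exists2 g, Ydual_ball g & phi = (fun f => g (T f))].

Definition ca_le (u : nat -> Y) (c : K) : Prop :=
  forall e : K, 0 < e -> exists N : nat,
    forall k l : nat, (N <= k)%N -> (N <= l)%N -> `|u k - u l| <= c + e.

Definition wuc_unit (x : nat -> Omega -> K) : Prop :=
  (forall n, C0 (x n)) /\
  forall phi, is_dual phi -> dnorm_le phi 1 ->
    forall N : nat, \sum_(n < N) `|phi (x n)| <= 1.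

Definition uc_le (T : (Omega -> K) -> Y) (c : K) : Prop :=
  forall x : nat -> Omega -> K, wuc_unit x ->
    ca_le (fun n => \sum_(i < n.+1) T (x i)) c.

Definition cvgK (u : nat -> K) (l : K) : Prop :=
  forall e : K, 0 < e -> exists N : nat, forall n, (N <= n)%N -> `|u n - l| < e.

Definition gamma_le (T : (Omega -> K) -> Y) (s : K) : Prop :=
  forall (f : nat -> Omega -> K) (g : nat -> Y -> K)
         (r : nat -> K) (q : nat -> K) (a b : K),
    (forall n, C0 (f n) /\ supnorm_le (f n) 1) ->
    (forall m, Ydual_ball (g m)) ->
    (forall n, cvgK (fun m => g m (T (f n))) (r n)) -> cvgK r a ->
    (forall m, cvgK (fun n => g m (T (f n))) (q m)) -> cvgK q b ->
    `|a - b| <= s.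

End Op.

Definition has_Vq : Prop :=
  exists2 C : K, 0 < C &
    forall (Y : completeNormedModType K) (T : (Omega -> K) -> Y),
      bounded_op T -> forall c, uc_le T c -> gamma_le T (C * c).

Definition has_Vq_wstar : Prop :=
  exists2 C : K, 0 < C &
    forall (Y : completeNormedModType K) (T : (Omega -> K) -> Y),
      bounded_op T -> forall c, uc_le T c -> omega_le (adj_ball_image T) (C * c).

End C0.

(* Main.v *)
Require Import Defs.
From HB Require Import structures.
From mathcomp Require Import all_boot all_order all_algebra.
From mathcomp Require Import all_classical all_reals all_analysis.
From mathcomp Require Import complex.
From mathcomp Require Import ring lra.
Import Order.TTheory GRing.Theory Num.Theory.
Import numFieldNormedType.Exports.
Set Implicit Arguments. Unset Strict Implicit. Unset Printing Implicit Defensive.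
Local Open Scope ring_scope.
Local Open Scope classical_set_scope.

(** Let [S] be the adjoint of [T], let [A] be the image of the unit ball of the dual
    of [Y] under [S], and let [d > uc(T)].  There is a positive functional [lam] on
    [C_0(Omega)] such that [|phi f| <= lam |f| + d ||f||] for all [phi] in [A]:
    otherwise one could choose [phi_n] in [A] and [f_n] with [sum_n |f_n| <= 1]
    pointwise and [|phi_n (f_n)|] bounded below by a constant larger than [uc(T)],
    whereas [sum_n f_n] is weakly unconditionally Cauchy.  By Hahn-Banach, each [phi]
    in [A] is then at distance at most [d] from the order interval
    [{psi : |psi f| <= lam |f|}], which is weakly compact because it embeds
    continuously in the dual of the Hilbert space [L^2(lam)].  This gives
    [omega(S) <= uc(T)] for both scalar fields, so the constants [pi] and [2] are not
    sharp; [gamma(T) <= 2 uc(T)] follows by exchanging limits along an ultrafilter. *)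

(** * Sublinear functionals and the Riesz representation *)

(** No constant is lost because a single term of a series is enough: [T x_n] is the difference of
    two consecutive partial sums, so its norm is eventually at most [uc(T)] plus any given error.
    The obstacle is weak compactness. Ultrafilter limits of functionals converge only at elements of
    [C_0], whereas the weak topology is tested by arbitrary elements of the bidual. On an order
    interval the two kinds of convergence agree, since there each bidual element is approximated,
    uniformly and to any precision, by an element of [C_0]. As [C_0] is not complete for the
    seminorm of [L^2(lam)], representing elements exist only up to an error; the one for the bidual
    element has to be chosen before the functional, so that the estimate is uniform. Measures never
    appear: a finite positive measure is replaced by its values on nonnegative functions, and a
    total variation by a supremum. The factor 2 for [gamma(T)] arises because the two iterated
    limits each lie within [uc(T)], up to an error, of one common number. *)

Section RealVectorSpaces.
Variables (R : realType) (V : lmodType R).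

Definition linear_form (u : V -> R) : Prop :=
  forall a x y, u (a *: x + y) = a * u x + u y.

Definition sublinear (p : V -> R) : Prop :=
  (forall x y, p (x + y) <= p x + p y) /\
  (forall a x, 0 <= a -> p (a *: x) = a * p x).

Lemma sublinear0 p : sublinear p -> p 0 = 0.
Proof. by move=> [_ pZ]; rewrite -(scale0r (0 : V)) pZ // mul0r. Qed.

Lemma sublinear_ge p : sublinear p -> forall x, - p (- x) <= p x.
Proof.
move=> ps x; have := ps.1 x (- x).
by rewrite subrr sublinear0 //; lra.
Qed.

(** For fixed [y], the infimum over [t >= 0] of [p (x + t *: y) - t * p y] is sublinear in [x] and
    lies below [p], so by minimality it equals [p]. The choice [t = 1] then gives
    [p x + p y <= p (x + y)]. *)
Lemma minimal_sublinear_linear (p : V -> R) : sublinear p ->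
  (forall s, sublinear s -> (forall x, s x <= p x) -> s = p) -> linear_form p.
Proof.
move=> ps pmin.
have padd y x : p (x + y) = p x + p y.
  pose E x := [set r | exists2 t : R, 0 <= t & r = p (x + t *: y) - t * p y].
  have Elb x' : lbound (E x') (- p (- x')).
    move=> _ [t t0 ->]; have := ps.1 (x' + t *: y) (- x').
    by rewrite addrC addKr ps.2 //; lra.
  have E0 x' : E x' (p x') by exists 0 => //; rewrite scale0r addr0 mul0r subr0.
  have infE x' : has_inf (E x') by split; [exists (p x')|exists (- p (- x'))].
  have Einf x' t : 0 <= t -> inf (E x') <= p (x' + t *: y) - t * p y.
    by move=> t0; apply: ge_inf; [exact: (infE x').2|exists t].
  have es : (fun x => inf (E x)) = p.
    apply: pmin; last by move=> x'; apply: ge_inf; [exact: (infE x').2|].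
    split.
      move=> x1 x2 /=; apply/ler_addgt0Pr => e e0.
      have e20 : 0 < e / 2 by rewrite divr_gt0.
      have [_ [t1 t10 ->] l1] := inf_adherent e20 (infE x1).
      have [_ [t2 t20 ->] l2] := inf_adherent e20 (infE x2).
      have := Einf (x1 + x2) (t1 + t2) (addr_ge0 t10 t20).
      rewrite scalerDl addrACA => h.
      by have := ps.1 (x1 + t1 *: y) (x2 + t2 *: y); lra.
    move=> a x' /=; rewrite le_eqVlt => /predU1P[<-|a0].
      rewrite scale0r mul0r; apply/eqP; rewrite eq_le; apply/andP; split.
        by rewrite -[leRHS](sublinear0 ps); apply: ge_inf; [exact: (infE 0).2|exact: E0].
      apply: lb_le_inf; first by exists (p 0).
      by move=> r /Elb; rewrite oppr0 sublinear0 // oppr0.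
    apply/eqP; rewrite eq_le; apply/andP; split.
      rewrite -ler_pdivrMl //; apply: lb_le_inf; first by exists (p x').
      move=> _ [t t0 ->]; rewrite ler_pdivrMl //.
      have := Einf (a *: x') (a * t) (mulr_ge0 (ltW a0) t0).
      by rewrite -scalerA -scalerDr (ps.2 _ _ (ltW a0)); lra.
    apply: lb_le_inf; first by exists (p (a *: x')).
    move=> _ [t t0 ->].
    have := Einf x' (a^-1 * t); rewrite mulr_ge0 ?invr_ge0 ?(ltW a0) // => /(_ isT).
    rewrite -(ler_pM2l a0) => /le_trans -> //.
    rewrite mulrBr -(ps.2 _ _ (ltW a0)) scalerDr scalerA !mulrA divff ?gt_eqF //.
    by rewrite !mul1r.
  apply/eqP; rewrite eq_le ps.1 /=.
  by have := Einf x 1 ler01; rewrite (congr1 (@^~ x) es) /= scale1r; lra.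
have pN x : p (- x) = - p x.
  by have := padd (- x) x; rewrite subrr sublinear0 //; lra.
move=> a x y; rewrite padd; congr (_ + _).
have [a0|/ltW a0] := leP 0 a; first exact: (ps.2 _ _ a0).
by rewrite -[a]opprK scaleNr pN ps.2 ?oppr_ge0 // [RHS]mulNr.
Qed.

(** Subadditivity survives the infimum because, of two members of a chain that are nearly optimal at
    [x] and at [y], the smaller serves both points. The bound by [q] keeps the infimum finite:
    [s x >= - s (- x) >= - q (- x)]. *)
Lemma sublinear_chain_inf (q : V -> R) (A : set (V -> R)) :
  A !=set0 -> (forall s, A s -> sublinear s) -> (forall s, A s -> forall x, s x <= q x) ->
  (forall s t, A s -> A t -> (forall x, s x <= t x) \/ (forall x, t x <= s x)) ->
  exists2 m, sublinear m & forall s, A s -> forall x, m x <= s x.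
Proof.
move=> [s0 As0] Asub Aq Atot.
pose E x := [set r | exists2 s, A s & r = s x].
have Elb x : lbound (E x) (- q (- x)).
  move=> _ [s As ->]; apply: le_trans (sublinear_ge (Asub s As) x).
  by rewrite lerN2 Aq.
have E0 x : E x !=set0 by exists (s0 x), s0.
have infE x : has_inf (E x) by split => //; exists (- q (- x)).
have Einf x s : A s -> inf (E x) <= s x.
  by move=> As; apply: ge_inf; [exact: (infE x).2|exists s].
exists (fun x => inf (E x)) => [|s As x]; last exact: Einf.
split.
  move=> x y /=; apply/ler_addgt0Pr => e e0.
  have e20 : 0 < e / 2 by rewrite divr_gt0.
  have [_ [s As ->] l1] := inf_adherent e20 (infE x).
  have [_ [t At ->] l2] := inf_adherent e20 (infE y).
  have [st|ts] := Atot s t As At.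
    by have := Einf (x + y) s As; have := (Asub s As).1 x y; have := st y; lra.
  by have := Einf (x + y) t At; have := (Asub t At).1 x y; have := ts x; lra.
move=> a x /=; rewrite le_eqVlt => /predU1P[<-|a0].
  rewrite scale0r mul0r; apply/eqP; rewrite eq_le; apply/andP; split.
    by have := Einf 0 s0 As0; rewrite sublinear0 //; exact: Asub.
  by apply: lb_le_inf => // _ [s As ->]; rewrite sublinear0 //; exact: Asub.
apply/eqP; rewrite eq_le; apply/andP; split.
  rewrite -ler_pdivrMl //; apply: lb_le_inf => // _ [s As ->].
  by rewrite ler_pdivrMl // -((Asub s As).2 _ _ (ltW a0)); exact: Einf.
apply: lb_le_inf => // _ [s As ->].
by rewrite ((Asub s As).2 _ _ (ltW a0)) ler_pM2l //; exact: Einf.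
Qed.

(** Zorn's lemma is applied to the sublinear functionals below [q], ordered downwards, instead of to
    extensions from subspaces; a minimal one is linear. *)
Lemma hahn_banach_sublinear (q : V -> R) : sublinear q ->
  exists2 u, linear_form u & forall x, u x <= q x.
Proof.
move=> qs; pose S := {s : V -> R | sublinear s /\ forall x, s x <= q x}.
pose le (s t : S) := `[< forall x, sval t x <= sval s x >].
have sval_eq (s t : S) : sval s = sval t -> s = t.
  by case: s t => [s ps] [t pt] /= e; subst t; congr exist; exact: Prop_irrelevance.
have [||||[m [ms mq]] mmax] := @Zorn S le.
- by move=> t; apply/asboolP.
- move=> r s t /asboolP rs /asboolP st; apply/asboolP => x.
  exact: le_trans (st x) (rs x).
- move=> s t /asboolP st /asboolP ts; apply: sval_eq; apply/funext => x.
  by apply: le_anti; rewrite st ts.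
- move=> A Atot; have [[s0 As0]|A0] := pselect (A !=set0); last first.
    have qq : sublinear q /\ forall x, q x <= q x by [].
    by exists (exist _ q qq) => s As; exfalso; apply: A0; exists s.
  have [||||m ms mle] := @sublinear_chain_inf q (@sval _ _ @` A).
  - by exists (sval s0), s0.
  - by move=> _ [s As <-]; exact: (svalP s).1.
  - by move=> _ [s As <-]; exact: (svalP s).2.
  - move=> _ _ [s As <-] [t At <-].
    by case: (Atot s t As At) => /asboolP h; [right|left].
  have mq : sublinear m /\ forall x, m x <= q x.
    split=> // x; apply: le_trans (mle (sval s0) _ x) ((svalP s0).2 x).
    by exists s0.
  exists (exist _ m mq) => s As; apply/asboolP => x /=; apply: mle.
  by exists s.
exists m => //; apply: minimal_sublinear_linear => // s ss sm.
have sq : sublinear s /\ forall x, s x <= q x.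
  by split=> // x; exact: le_trans (sm x) (mq x).
have := mmax (exist _ s sq); rewrite /le /=.
by move=> /(_ (asboolT sm)) /(congr1 sval).
Qed.

Lemma discriminant_le (a b c : R) : 0 <= a ->
  (forall s, 0 <= a * s ^+ 2 - 2 * b * s + c) -> b ^+ 2 <= a * c.
Proof.
rewrite le_eqVlt => /predU1P[<-|a0] h.
  rewrite mul0r; have [->|b0] := eqVneq b 0; first by rewrite expr0n.
  (* For [a = 0] the expression is affine in [s] and equals [-1] at this point. *)
  have := h ((c + 1) / (2 * b)).
  by rewrite mul0r add0r mulrCA divff ?mulf_neq0 // mulr1; lra.
have := h (b / a).
rewrite -(ler_pM2l a0) mulr0.
suff -> : a * (a * (b / a) ^+ 2 - 2 * b * (b / a) + c) = a * c - b ^+ 2 by lra.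
by field; rewrite gt_eqF.
Qed.

Definition semi_inner (B : V -> V -> R) : Prop :=
  [/\ forall x y, B x y = B y x,
      forall x, linear_form (B x) & forall x, 0 <= B x x].

Lemma semi_inner_CS (B : V -> V -> R) : semi_inner B ->
  forall x y, B x y ^+ 2 <= B x x * B y y.
Proof.
move=> [Bsym Blin Bpos] x y; apply: discriminant_le => // s.
have := Bpos ((- s) *: x + y).
by rewrite Blin ![B (_ *: _ + _) _]Bsym !Blin (Bsym y x); nra.
Qed.

(* Minimise [B y y - 2 l y]; the space need not be complete, whence the error. *)
Lemma riesz_approx (B : V -> V -> R) (l : V -> R) (C : R) :
  semi_inner B -> linear_form l -> (forall x, (l x) ^+ 2 <= C * B x x) ->
  forall eta, 0 < eta ->
  exists y, forall x, (B y x - l x) ^+ 2 <= eta * B x x.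
Proof.
move=> [Bsym Blin Bpos] llin lC eta eta0.
have lC' x : (l x) ^+ 2 <= `|C| * B x x.
  by apply: le_trans (lC x) _; rewrite ler_wpM2r // ler_norm.
pose F y := B y y - 2 * l y.
pose E := [set F y | y in setT].
have infE : has_inf E.
  split; first by exists (F 0), 0.
  exists (- `|C|) => _ [y _ <-]; rewrite /F.
  (* In the second case the inequality of arithmetic and geometric means would give [l y ^+ 2]
     larger than the product of [B y y] and the absolute value of [C], against [lC']. *)
  have [cB|cB] := leP (l y) ((`|C| + B y y) / 2); first lra.
  have := lC' y; have := Bpos y; have := normr_ge0 C.
  have : ((`|C| + B y y) / 2) ^+ 2 < (l y) ^+ 2.
    by rewrite ltrXn2r ?nnegrE // ?(lt_le_trans _ (ltW cB)) // ?divr_ge0 ?addr_ge0 //;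
       apply: le_trans (ltW cB); rewrite divr_ge0 ?addr_ge0.
  by have := sqr_ge0 (`|C| - B y y); nra.
have [_ [y _ <-] Fy] := inf_adherent eta0 infE.
have Fmin z : F y <= F z + eta.
  have : inf E <= F z by apply: ge_inf; [exact: infE.2|exists z].
  lra.
(* Near-minimality of [y] along the line [y - s x] says that [B x x * s ^+ 2 - 2 * (B y x - l x) * s
   + eta] is never negative; its discriminant gives the claim. *)
exists y => x; rewrite mulrC; apply: discriminant_le => // s.
have := Fmin ((- s) *: x + y); rewrite /F.
by rewrite Blin llin ![B (_ *: _ + _) _]Bsym !Blin (Bsym x y); nra.
Qed.

End RealVectorSpaces.

Lemma ultra_bounded_cvg (T : Type) (G : set_system T) (R : realType)
    (F : T -> R) (M : R) :
  UltraFilter G -> G [set t | `|F t| <= M] -> exists l : R, F @ G --> l.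
Proof.
move=> GU GM.
have GF : (F @ G) `[(- M), M]%classic.
  have -> : `[(- M), M]%classic = [set r | `|r| <= M]; last exact: GM.
  by rewrite set_itvcc; apply/seteqP; split=> r /=; rewrite ler_norml.
have [l [_ cl]] := @segment_compact R (- M) M (F @ G) _ GF.
exists l => A Al; have [//|GnA] := in_ultra_setVsetC (F @^-1` A) GU.
by have [r [nAr Ar]] := cl (~` A) A GnA Al.
Qed.

(** * Scalars and spaces of continuous functions *)

(* A common interface for the scalar fields [R] (with [jj = 0]) and [R[i]]
   (with [jj = 'i]); [re (jj * z)] is minus the imaginary part of [z]. *)
Record scalars (R : realType) (K : numFieldType) := Scalars {
  ofR : {rmorphism R -> K};
  re : K -> R;
  nrm : K -> R;
  jj : K;
  normE : forall z, `|z| = ofR (nrm z);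
  ofR_le : forall a b, (ofR a <= ofR b) = (a <= b);
  reD : forall y z, re (y + z) = re y + re z;
  reZ : forall a z, re (ofR a * z) = a * re z;
  re_ofR : forall a, re (ofR a) = a;
  re_jj : forall a, re (jj * ofR a) = 0;
  nrm_sqr : forall z, nrm z ^+ 2 = re z ^+ 2 + re (jj * z) ^+ 2;
  re_decomp : forall z, z = ofR (re z) - jj * ofR (re (jj * z));
  jj_cases : jj = 0 \/ jj * jj = -1 }.

Lemma real_scalars (R : realType) : scalars R R.
Proof.
apply: (@Scalars R R idfun id Num.norm 0) => //=.
- by move=> a; rewrite mul0r.
- by move=> z; rewrite mul0r expr0n addr0 real_normK ?num_real.
- by move=> z; rewrite mul0r subr0.
- by left.
Defined.

Lemma complex_scalars (R : realType) : scalars R R[i].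
Proof.
apply: (@Scalars R R[i] (real_complex R) (@complex.Re R)
  (fun z => complex.Re `|z|) 'i%C).
- by case=> a b; rewrite normc_def.
- by move=> a b; rewrite lecR.
- by case=> a b [c d].
- by move=> a [b c] /=; lra.
- by [].
- by move=> a /=; lra.
- by case=> a b; rewrite normc_def /= sqr_sqrtr ?addr_ge0 ?sqr_ge0 //; lra.
- by case=> a b; apply/eqP; rewrite eq_complex /=; apply/andP; split; apply/eqP; lra.
- by right; apply/eqP; rewrite eq_complex /=; apply/andP; split; apply/eqP; lra.
Defined.

Section Scalars.
Variables (R : realType) (K : numFieldType) (S : scalars R K).
Local Notation ofR := (ofR S).
Local Notation re := (re S).
Local Notation nrm := (nrm S).
Local Notation jj := (jj S).

Lemma ofR_lt a b : (ofR a < ofR b) = (a < b).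
Proof. by rewrite !lt_neqAle (ofR_le S) (inj_eq (fmorph_inj _)). Qed.

Lemma ofR_ge0 a : (0 <= ofR a) = (0 <= a).
Proof. by rewrite -(rmorph0 ofR) (ofR_le S). Qed.

Lemma ofR_gt0 a : (0 < ofR a) = (0 < a).
Proof. by rewrite -(rmorph0 ofR) ofR_lt. Qed.

Lemma norm_le_ofR z a : (`|z| <= ofR a) = (nrm z <= a).
Proof. by rewrite (normE S) (ofR_le S). Qed.

Lemma norm_lt_ofR z a : (`|z| < ofR a) = (nrm z < a).
Proof. by rewrite (normE S) ofR_lt. Qed.

Lemma nrm_ge0 z : 0 <= nrm z.
Proof. by rewrite -(ofR_ge0) -(normE S). Qed.

Lemma nrm0 : nrm 0 = 0.
Proof. by apply: (fmorph_inj ofR); rewrite -(normE S) normr0 rmorph0. Qed.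

Lemma nrmM y z : nrm (y * z) = nrm y * nrm z.
Proof. by apply: (fmorph_inj ofR); rewrite rmorphM -!(normE S) normrM. Qed.

Lemma nrmN z : nrm (- z) = nrm z.
Proof. by apply: (fmorph_inj ofR); rewrite -!(normE S) normrN. Qed.

Lemma nrmD y z : nrm (y + z) <= nrm y + nrm z.
Proof. by rewrite -(ofR_le S) rmorphD -!(normE S) ler_normD. Qed.

Lemma nrmB y z : nrm (y - z) <= nrm y + nrm z.
Proof. by rewrite -(nrmN z) nrmD. Qed.

Lemma nrmBC y z : nrm (y - z) = nrm (z - y).
Proof. by rewrite -nrmN opprB. Qed.

Lemma dist_nrm y z : `|nrm y - nrm z| <= nrm (y - z).
Proof.
have := nrmD (y - z) z; have := nrmD (z - y) y.
by rewrite !subrK (nrmBC z) ler_norml; lra.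
Qed.

Lemma ge0_ofR e : 0 <= e -> e = ofR (nrm e).
Proof. by move=> e0; rewrite -(normE S) ger0_norm. Qed.

Lemma nrm_ofR a : 0 <= a -> nrm (ofR a) = a.
Proof. by move=> a0; apply: (fmorph_inj ofR); rewrite -ge0_ofR ?ofR_ge0. Qed.

Lemma nrm1 : nrm 1 = 1.
Proof. by rewrite -(rmorph1 ofR) nrm_ofR. Qed.

Lemma nrm_gt0 e : 0 < e -> 0 < nrm e.
Proof. by move=> e0; rewrite -ofR_gt0 -ge0_ofR // ltW. Qed.

Lemma re0 : re 0 = 0.
Proof. by rewrite -(rmorph0 ofR) re_ofR. Qed.

Lemma reN z : re (- z) = - re z.
Proof. by have := reD S z (- z); rewrite subrr re0; lra. Qed.

Lemma re_le_nrm z : `|re z| <= nrm z.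
Proof.
rewrite -(@ler_pXn2r _ 2) ?nnegrE ?nrm_ge0 // real_normK ?num_real //.
by rewrite nrm_sqr lerDl sqr_ge0.
Qed.

Lemma re_phase z : exists2 t, nrm t = 1 & re (t * z) = nrm z.
Proof.
have [->|z0] := eqVneq z 0; first by exists 1; rewrite ?nrm1 // mulr0 re0 nrm0.
exists (`|z| / z).
  apply: (fmorph_inj ofR); rewrite -(normE S) normrM normr_id normfV divff ?rmorph1 //.
  by rewrite normr_eq0.
by rewrite divfK // (normE S) re_ofR.
Qed.

Lemma lipschitz_continuous (g : K -> R) :
  (forall y z, `|g y - g z| <= nrm (y - z)) -> continuous g.
Proof.
move=> gl z; apply/(@cvgrPdist_lt _ _ _ (nbhs z) (@nbhs_filter K z)) => e e0.
apply/nbhs_normP; exists (ofR e) => [|y /=]; first by rewrite /= ofR_gt0.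
by rewrite norm_lt_ofR; exact: le_lt_trans.
Qed.

Lemma nrm_continuous : continuous nrm.
Proof. by apply: lipschitz_continuous; exact: dist_nrm. Qed.

Lemma re_continuous : continuous re.
Proof.
by apply: lipschitz_continuous => y z; rewrite -reN -reD re_le_nrm.
Qed.

Lemma ofR_continuous : continuous (ofR : R -> K).
Proof.
move=> a; apply/cvgrPdist_lt => e e0.
apply/nbhs_normP; exists (nrm e) => [|b /= abe]; first exact: nrm_gt0.
rewrite (ge0_ofR (ltW e0)) norm_lt_ofR -rmorphB.
by have [ab|ba] := leP 0 (a - b); [|rewrite -nrmN -rmorphN];
   rewrite nrm_ofR ?oppr_ge0 ?(ltW ba) // (le_lt_trans _ abe) // ?ler_norm // -normrN ler_norm.
Qed.

Lemma ultra_bounded_cvg_scalar (T : Type) (G : set_system T) (F : T -> K) (M : R) :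
  UltraFilter G -> G [set t | nrm (F t) <= M] -> exists l : K, F @ G --> l.
Proof.
move=> GU GM.
have [|a Fa] := @ultra_bounded_cvg T G R (fun t => re (F t)) M GU.
  by apply: filterS GM => t; exact: le_trans (re_le_nrm _).
have [|b Fb] := @ultra_bounded_cvg T G R (fun t => re (jj * F t)) (nrm jj * M) GU.
  apply: filterS GM => t /= FM; apply: le_trans (re_le_nrm _) _.
  by rewrite nrmM ler_wpM2l // nrm_ge0.
exists (ofR a - jj * ofR b).
rewrite (_ : F = fun t => ofR (re (F t)) - jj * ofR (re (jj * F t))); last first.
  by apply/funext => t; exact: re_decomp.
apply: cvgB; first by apply: (cvg_comp _ _ Fa); exact: ofR_continuous.
by apply: cvgMr; apply: (cvg_comp _ _ Fb); exact: ofR_continuous.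
Qed.

End Scalars.

Section C0Facts.
Variables (R : realType) (K : numFieldType) (S : scalars R K).
Variable Omega : topologicalType.
Local Notation ofR := (ofR S).
Local Notation nrm := (nrm S).

Lemma scontP (L : numFieldType) (f : Omega -> L) : scont f <-> continuous f.
Proof.
split=> fc w; last first.
  move=> e e0; have /cvgrPdist_lt/(_ e e0) := fc w.
  by apply: filterS => z; rewrite distrC.
apply/cvgrPdist_lt => e e0; apply: filterS (fc w e e0) => z.
by rewrite distrC.
Qed.

Lemma C0P (f : Omega -> K) : C0 f <->
  continuous f /\ forall r, 0 < r -> compact [set w | r <= nrm (f w)].
Proof.
split=> -[fc fv]; split; try exact/scontP.
  move=> r r0; rewrite (_ : mkset _ = [set w | ofR r <= `|f w|]).
    by apply: fv; rewrite ofR_gt0.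
  by apply/seteqP; split=> w /=; rewrite (normE S) (ofR_le S).
move=> e e0; rewrite (_ : mkset _ = [set w | nrm e <= nrm (f w)]).
  by apply: fv; exact: nrm_gt0.
suff E w : (e <= `|f w|) = (nrm e <= nrm (f w)) by apply/seteqP; split=> w /=; rewrite E.
by rewrite [in LHS](ge0_ofR S (ltW e0)) (normE S) (ofR_le S).
Qed.

Lemma closed_nrm_ge (f : Omega -> K) r :
  continuous f -> closed [set w | r <= nrm (f w)].
Proof.
move=> fc; apply: (@closed_comp _ _ (nrm \o f) [set x | r <= x]); last exact: closed_ge.
by move=> w _; apply: continuous_comp; [exact: fc|exact: nrm_continuous].
Qed.

Lemma C0_continuous (f : Omega -> K) : C0 f -> continuous f.
Proof. by move=> /C0P[]. Qed.

Lemma C0_compact (f : Omega -> K) r : C0 f -> 0 < r -> compact [set w | r <= nrm (f w)].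
Proof. by move=> /C0P[_]; exact. Qed.

Lemma C0D (f g : Omega -> K) : C0 f -> C0 g -> C0 (fun w => f w + g w).
Proof.
move=> Cf Cg; apply/C0P.
have fgc : continuous (fun w => f w + g w).
  by move=> w; apply: cvgD; apply: C0_continuous.
split=> // r r0; have r20 : 0 < r / 2 by rewrite divr_gt0.
apply: (subclosed_compact (closed_nrm_ge (r := r) fgc)
  (compactU (C0_compact Cf r20) (C0_compact Cg r20))).
move=> w /= rfg; have := nrmD S (f w) (g w).
have [|fr] := leP (r / 2) (nrm (f w)); first by left.
by right; lra.
Qed.

Lemma C0_scale a (f : Omega -> K) : C0 f -> C0 (fun w => a * f w).
Proof.
move=> Cf; apply/C0P.
have afc : continuous (fun w => a * f w).
  by move=> w; apply: cvgMr; exact: C0_continuous.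
split=> // r r0; have [a0|a0] := leP (nrm a) 0.
  rewrite (_ : mkset _ = set0); first exact: compact0.
  apply/seteqP; split=> w //=; rewrite nrmM.
  by have := nrm_ge0 S (f w); have := nrm_ge0 S a; nra.
apply: (subclosed_compact (closed_nrm_ge (r := r) afc)
  (C0_compact Cf (divr_gt0 r0 a0))).
by move=> w /=; rewrite nrmM ler_pdivrMr // mulrC.
Qed.

Lemma C0_zero : C0 (fun _ : Omega => 0 : K).
Proof.
apply/C0P; split=> [w|r r0]; first exact: cvg_cst.
rewrite (_ : mkset _ = set0); first exact: compact0.
by apply/seteqP; split=> w //=; rewrite nrm0; lra.
Qed.

Lemma C0_lin a (f g : Omega -> K) : C0 f -> C0 g -> C0 (fun w => a * f w + g w).
Proof. by move=> Cf Cg; apply: C0D => //; exact: C0_scale. Qed.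

Lemma C0_bounded (f : Omega -> K) : C0 f -> exists2 M, 0 < M & forall w, nrm (f w) <= M.
Proof.
move=> Cf; have cpt := C0_compact Cf ltr01.
have cf : continuous (nrm \o f).
  by move=> w; apply: continuous_comp; [exact: C0_continuous|exact: nrm_continuous].
have : compact ((nrm \o f) @` [set w | 1 <= nrm (f w)]).
  by apply: continuous_compact => //; exact: continuous_subspaceT.
move=> /compact_bounded[M [Mr Mb]].
exists (`|M| + 1) => [|w]; first by rewrite ltr_wpDl.
have [f1|f1] := leP 1 (nrm (f w)); last by have := normr_ge0 M; lra.
apply: le_trans (ler_norm _) _; apply: (Mb (`|M| + 1)); last by exists w.
by rewrite (le_lt_trans (ler_norm M)) // ltrDl.
Qed.

End C0Facts.

(** * Positive functionals *)

Section C0More.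
Variables (R : realType) (K : numFieldType) (S : scalars R K).
Variable Omega : topologicalType.
Local Notation nrm := (nrm S).

Lemma nrm_comp_continuous (f : Omega -> K) : continuous f -> continuous (fun w => nrm (f w)).
Proof. by move=> fc w; apply: (continuous_comp (fc w)); exact: nrm_continuous. Qed.

Lemma C0_dom (f : Omega -> K) (u : Omega -> R) :
  continuous f -> C0 u -> (forall w, nrm (f w) <= u w) -> C0 f.
Proof.
move=> fc Cu fu; apply/(C0P S); split=> // r r0.
apply: (subclosed_compact (closed_nrm_ge (r := r) fc)
  (C0_compact (S := real_scalars R) Cu r0)) => w /= rf.
exact: le_trans rf (le_trans (fu w) (ler_norm _)).
Qed.

Lemma C0_nrm (f : Omega -> K) : C0 f -> C0 (fun w => nrm (f w)).
Proof.
move=> Cf; apply/(C0P (real_scalars R)); split.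
  by apply: nrm_comp_continuous; exact: (C0_continuous S).
move=> r r0; rewrite (_ : mkset _ = [set w | r <= nrm (f w)]).
  exact: C0_compact.
by apply/seteqP; split=> w /=; rewrite ger0_norm // nrm_ge0.
Qed.

End C0More.

Section RealC0.
Variables (R : realType) (Omega : topologicalType).
Implicit Types u v : Omega -> R.

Lemma C0_add u v : C0 u -> C0 v -> C0 (fun w => u w + v w).
Proof. exact: (C0D (real_scalars R)). Qed.

Lemma C0_sub u v : C0 u -> C0 v -> C0 (fun w => u w - v w).
Proof.
move=> Cu Cv.
rewrite (_ : (fun w => _) = (fun w => -1 * v w + u w)).
  exact: (C0_lin (real_scalars R)).
by apply/funext => w; lra.
Qed.

Lemma C0_mulr a u : C0 u -> C0 (fun w => a * u w).
Proof. exact: (C0_scale (real_scalars R)). Qed.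

Lemma C0_mul u v : C0 u -> C0 v -> C0 (fun w => u w * v w).
Proof.
move=> Cu Cv; have [M M0 uM] := C0_bounded (real_scalars R) Cu.
apply: (@C0_dom _ _ (real_scalars R) _ _ (fun w => M * `|v w|)).
- by move=> w; apply: cvgM; apply: (C0_continuous (real_scalars R)).
- by apply: C0_mulr; exact: (C0_nrm (real_scalars R)).
by move=> w /=; rewrite normrM ler_wpM2r //; exact: uM.
Qed.

Definition cone u : Prop := C0 u /\ forall w, 0 <= u w.

Lemma cone0 : cone (fun=> 0).
Proof. by split=> //; exact: (C0_zero (real_scalars R)). Qed.

Lemma coneD u v : cone u -> cone v -> cone (fun w => u w + v w).
Proof. by move=> [Cu u0] [Cv v0]; split=> [|w]; [exact: C0_add|exact: addr_ge0]. Qed.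

Lemma coneZ a u : 0 <= a -> cone u -> cone (fun w => a * u w).
Proof. by move=> a0 [Cu u0]; split=> [|w]; [exact: C0_mulr|exact: mulr_ge0]. Qed.

Definition pospart u w := (`|u w| + u w) / 2.
Definition negpart u w := (`|u w| - u w) / 2.

Lemma cone_pospart u : C0 u -> cone (pospart u).
Proof.
move=> Cu; split=> [|w]; last first.
  by rewrite /pospart; have := ler_norm (- u w); rewrite normrN; lra.
rewrite (_ : pospart u = fun w => 2^-1 * (`|u w| + u w)).
  by apply: C0_mulr; apply: C0_add => //; exact: (C0_nrm (real_scalars R)).
by apply/funext => w; rewrite mulrC.
Qed.

Lemma cone_negpart u : C0 u -> cone (negpart u).
Proof.
move=> Cu; split=> [|w]; last by rewrite /negpart; have := ler_norm (u w); lra.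
rewrite (_ : negpart u = fun w => 2^-1 * (`|u w| - u w)).
  by apply: C0_mulr; apply: C0_sub => //; exact: (C0_nrm (real_scalars R)).
by apply/funext => w; rewrite mulrC.
Qed.

(** Stands for a finite positive measure. Only values on the cone are constrained, since that is
    where total variations are additive and where their ultralimits are taken; the last clause
    bounds the total mass by [L]. *)
Definition positive_functional (lam : (Omega -> R) -> R) : Prop :=
  [/\ forall u, cone u -> 0 <= lam u,
      forall u v, cone u -> cone v -> lam (fun w => u w + v w) = lam u + lam v,
      forall a u, 0 <= a -> cone u -> lam (fun w => a * u w) = a * lam u &
      exists2 L, 0 <= L & forall u t, cone u -> 0 <= t -> (forall w, u w <= t) ->
        lam u <= L * t].

Variable lam : (Omega -> R) -> R.
Hypothesis lamP : positive_functional lam.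

Lemma lam_ge0 u : cone u -> 0 <= lam u.
Proof. by have [h _ _ _] := lamP; exact: h. Qed.

Lemma lamD u v : cone u -> cone v -> lam (fun w => u w + v w) = lam u + lam v.
Proof. by have [_ h _ _] := lamP; exact: h. Qed.

Lemma lamZ a u : 0 <= a -> cone u -> lam (fun w => a * u w) = a * lam u.
Proof. by have [_ _ h _] := lamP; exact: h. Qed.

Lemma lam0 : lam (fun=> 0) = 0.
Proof.
have := lamD cone0 cone0.
by rewrite (_ : (fun w => 0 + 0) = fun=> 0); [lra|apply/funext => w; rewrite addr0].
Qed.

Lemma lam_mono u v : cone u -> cone v -> (forall w, u w <= v w) -> lam u <= lam v.
Proof.
move=> cu cv uv.
have cvu : cone (fun w => v w - u w).
  by split=> [|w]; [apply: C0_sub; [exact: cv.1|exact: cu.1]|rewrite subr_ge0].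
rewrite (_ : v = fun w => u w + (v w - u w)); last by apply/funext => w; lra.
by rewrite lamD // lerDl lam_ge0.
Qed.

Definition lam_ext u := lam (pospart u) - lam (negpart u).

(** Additivity on the cone, applied to [p + negpart u = q + pospart u], makes the extension
    independent of the decomposition; linearity is then checked on convenient decompositions. *)
Lemma lam_extE p q u : cone p -> cone q -> (forall w, u w = p w - q w) ->
  lam_ext u = lam p - lam q.
Proof.
move=> cp cq upq.
have Cu : C0 u.
  by rewrite (_ : u = fun w => p w - q w); [exact: C0_sub cp.1 cq.1|exact/funext].
have cpu := cone_pospart Cu; have cnu := cone_negpart Cu.
have := lamD cp cnu; have := lamD cq cpu.
rewrite (_ : (fun w => p w + _) = (fun w => q w + pospart u w)).
  by rewrite /lam_ext => -> ?; lra.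
by apply/funext => w; rewrite /pospart /negpart; have := upq w; lra.
Qed.

Lemma lam_ext_cone u : cone u -> lam_ext u = lam u.
Proof.
move=> cu; rewrite (lam_extE cu cone0) => [|w]; last by rewrite subr0.
by rewrite lam0 subr0.
Qed.

Lemma lam_ext_lin a u v : C0 u -> C0 v ->
  lam_ext (fun w => a * u w + v w) = a * lam_ext u + lam_ext v.
Proof.
move=> Cu Cv.
have pu := cone_pospart Cu; have nu := cone_negpart Cu.
have pv := cone_pospart Cv; have nv := cone_negpart Cv.
have [a0|a0] := leP 0 a.
  rewrite (@lam_extE (fun w => a * pospart u w + pospart v w)
                     (fun w => a * negpart u w + negpart v w)).
  - by rewrite !lamD ?lamZ //; [rewrite /lam_ext; lra|exact: coneZ|exact: coneZ].
  - by apply: coneD => //; exact: coneZ.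
  - by apply: coneD => //; exact: coneZ.
  - by move=> w; rewrite /pospart /negpart; lra.
have a0' : 0 <= - a by lra.
rewrite (@lam_extE (fun w => - a * negpart u w + pospart v w)
                   (fun w => - a * pospart u w + negpart v w)).
- by rewrite !lamD ?lamZ //; [rewrite /lam_ext; lra|exact: coneZ|exact: coneZ].
- by apply: coneD => //; exact: coneZ.
- by apply: coneD => //; exact: coneZ.
- by move=> w; rewrite /pospart /negpart; lra.
Qed.

End RealC0.

(** * [C_0] as a real vector space with the semi-inner product of [L^2(lam)] *)

Section C0Space.
Variables (R : realType) (K : numFieldType) (S : scalars R K).
Variable Omega : topologicalType.
Local Notation ofR := (ofR S).
Local Notation re := (re S).
Local Notation nrm := (nrm S).
Local Notation jj := (jj S).

(** The space is taken over [R] even for complex [K], because the Hahn-Banach and Riesz lemmas above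
    are real. The phantom argument ties the type to one embedding of [R] in [K], from which the
    instances below take their scalar multiplication. *)
Definition C0space (_ : scalars R K) := {f : Omega -> K | C0 f}.
Local Notation X := (C0space S).

HB.instance Definition _ := gen_eqMixin X.
HB.instance Definition _ := gen_choiceMixin X.

Lemma C0space_eq (x y : X) : (forall w, sval x w = sval y w) -> x = y.
Proof.
case: x y => [f Cf] [g Cg] /= /funext fg; subst g.
by congr exist; exact: Prop_irrelevance.
Qed.

Definition C0space_zero : X := exist _ _ (C0_zero S Omega).
Definition C0space_opp (x : X) : X := exist _ _ (C0_scale S (-1) (svalP x)).
Definition C0space_add (x y : X) : X := exist _ _ (C0D S (svalP x) (svalP y)).
Definition C0space_scale (a : R) (x : X) : X := exist _ _ (C0_scale S (ofR a) (svalP x)).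

Fact C0space_addA : associative C0space_add.
Proof. by move=> x y z; apply: C0space_eq => w /=; rewrite addrA. Qed.
Fact C0space_addC : commutative C0space_add.
Proof. by move=> x y; apply: C0space_eq => w /=; rewrite addrC. Qed.
Fact C0space_add0 : left_id C0space_zero C0space_add.
Proof. by move=> x; apply: C0space_eq => w /=; rewrite add0r. Qed.
Fact C0space_addN : left_inverse C0space_zero C0space_opp C0space_add.
Proof. by move=> x; apply: C0space_eq => w /=; rewrite mulN1r addNr. Qed.

HB.instance Definition _ := GRing.isZmodule.Build X
  C0space_addA C0space_addC C0space_add0 C0space_addN.

Fact C0space_scaleA a b (x : X) :
  C0space_scale a (C0space_scale b x) = C0space_scale (a * b) x.
Proof. by apply: C0space_eq => w /=; rewrite rmorphM mulrA. Qed.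
Fact C0space_scale1 : left_id 1 C0space_scale.
Proof. by move=> x; apply: C0space_eq => w /=; rewrite rmorph1 mul1r. Qed.
Fact C0space_scaleDr : right_distributive C0space_scale +%R.
Proof. by move=> a x y; apply: C0space_eq => w /=; rewrite mulrDr. Qed.
Fact C0space_scaleDl (x : X) : {morph C0space_scale^~ x : a b / a + b}.
Proof. by move=> a b; apply: C0space_eq => w /=; rewrite rmorphD mulrDl. Qed.

HB.instance Definition _ := GRing.Zmodule_isLmodule.Build R X
  C0space_scaleA C0space_scale1 C0space_scaleDr C0space_scaleDl.

(** The default [0] outside [C_0] lets a functional on [X] be read as a total function on
    [Omega -> K]. *)
Definition toC0 (f : Omega -> K) : X :=
  if pselect (C0 f) is left Cf then exist _ f Cf else 0.

Lemma toC0K (f : Omega -> K) : C0 f -> sval (toC0 f) = f.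
Proof. by rewrite /toC0; case: pselect. Qed.

Lemma toC0_lin a (f g : Omega -> K) : C0 f -> C0 g ->
  toC0 (fun w => ofR a * f w + g w) = a *: toC0 f + toC0 g.
Proof.
move=> Cf Cg; apply: C0space_eq => w; rewrite toC0K /=; last exact: (C0_lin S).
by rewrite !toC0K.
Qed.

(** The real part of [y] times the conjugate of [z]; integrated against [lam] it gives the real part
    of the inner product of [L^2(lam)]. *)
Definition dot (y z : K) := re y * re z + re (jj * y) * re (jj * z).

Lemma dot_nrm z : dot z z = nrm z ^+ 2.
Proof. by rewrite nrm_sqr /dot !expr2. Qed.

Lemma C0_re (f : Omega -> K) : C0 f -> C0 (fun w => re (f w)).
Proof.
move=> Cf; apply: (@C0_dom _ _ (real_scalars R) _ _ (fun w => nrm (f w))).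
- have fc : continuous f by exact: (C0_continuous S).
  by move=> w; apply: (continuous_comp (fc w)); exact: re_continuous.
- exact: C0_nrm.
- by move=> w /=; exact: re_le_nrm.
Qed.

Lemma C0_dot (f g : Omega -> K) : C0 f -> C0 g -> C0 (fun w => dot (f w) (g w)).
Proof.
move=> Cf Cg; have Cjf := C0_scale S jj Cf; have Cjg := C0_scale S jj Cg.
by apply: C0_add; apply: C0_mul; exact: C0_re.
Qed.

Lemma cone_nrm (f : Omega -> K) : C0 f -> cone (fun w => nrm (f w)).
Proof. by move=> Cf; split=> [|w]; [exact: C0_nrm|exact: nrm_ge0]. Qed.

Lemma cone_nrm2 (f : Omega -> K) : C0 f -> cone (fun w => nrm (f w) ^+ 2).
Proof.
by move=> Cf; split=> [|w]; [apply: C0_mul; exact: C0_nrm|exact: sqr_ge0].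
Qed.

Definition C0_inner (lam : (Omega -> R) -> R) (x y : X) : R :=
  lam_ext lam (fun w => dot (sval x w) (sval y w)).

Lemma C0_innerE lam (x : X) : positive_functional lam ->
  C0_inner lam x x = lam (fun w => nrm (sval x w) ^+ 2).
Proof.
move=> lamP; rewrite /C0_inner (_ : (fun w => dot _ _) = fun w => nrm (sval x w) ^+ 2).
  by apply: lam_ext_cone => //; exact: cone_nrm2 (svalP x).
by apply/funext => w; exact: dot_nrm.
Qed.

Lemma C0_semi_inner lam : positive_functional lam -> semi_inner (C0_inner lam).
Proof.
move=> lamP; split=> [x y|x a y z|x].
- congr lam_ext; apply/funext => w.
  by rewrite /dot mulrC [X in _ + X]mulrC.
- rewrite /C0_inner -lam_ext_lin //; try exact: C0_dot (svalP _) (svalP _).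
  congr lam_ext; apply/funext => w /=.
  rewrite /dot [jj * (_ + _)]mulrDr !reD mulrCA !reZ; lra.
- by rewrite C0_innerE //; apply: lam_ge0 => //; exact: cone_nrm2 (svalP x).
Qed.

End C0Space.

(** * Dual and bidual *)

Section Functionals.
Variables (R : realType) (K : numFieldType) (S : scalars R K).
Variable Omega : topologicalType.
Local Notation ofR := (ofR S).
Local Notation re := (re S).
Local Notation nrm := (nrm S).
Local Notation jj := (jj S).
Local Notation X := (C0space Omega S).
Local Notation toC0 := (toC0 S).
Implicit Types (phi psi : (Omega -> K) -> K) (f g : Omega -> K) (x y : X).

Lemma lin0 phi : lin_on_C0 phi -> phi (fun=> 0) = 0.
Proof.
move=> phil; have := phil 1 _ _ (C0_zero S Omega) (C0_zero S Omega).
rewrite (_ : (fun w => 1 * 0 + 0) = fun=> 0); last first.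
  by apply/funext => w; rewrite mul1r addr0.
by move/eqP; rewrite mul1r -subr_eq0 opprD addrA subrr add0r oppr_eq0 => /eqP.
Qed.

Lemma linD phi f g : lin_on_C0 phi -> C0 f -> C0 g ->
  phi (fun w => f w + g w) = phi f + phi g.
Proof.
move=> phil Cf Cg; rewrite -[phi f]mul1r -phil //.
by congr phi; apply/funext => w; rewrite mul1r.
Qed.

Lemma linZ phi a f : lin_on_C0 phi -> C0 f -> phi (fun w => a * f w) = a * phi f.
Proof.
move=> phil Cf; rewrite -[RHS]addr0 -(lin0 phil) -phil //; last exact: (C0_zero S).
by congr phi; apply/funext => w; rewrite addr0.
Qed.

Lemma linB phi f g : lin_on_C0 phi -> C0 f -> C0 g ->
  phi (fun w => f w - g w) = phi f - phi g.
Proof.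
move=> phil Cf Cg; rewrite -mulN1r addrC -phil //.
by congr phi; apply/funext => w; rewrite mulN1r addrC.
Qed.

Lemma lin_phase phi f : lin_on_C0 phi -> C0 f ->
  exists2 t, nrm t = 1 & re (phi (fun w => t * f w)) = nrm (phi f).
Proof.
move=> phil Cf; have [t t1 tphi] := re_phase S (phi f).
by exists t => //; rewrite linZ.
Qed.

Lemma lin_sub phi psi : lin_on_C0 phi -> lin_on_C0 psi -> lin_on_C0 (fun f => phi f - psi f).
Proof. by move=> phil psil a f g Cf Cg; rewrite phil // psil //; ring. Qed.

Definition bounded_by (phi : (Omega -> K) -> K) (s : R) : Prop :=
  forall f t, C0 f -> 0 <= t -> (forall w, nrm (f w) <= t) -> nrm (phi f) <= s * t.

Lemma dnorm_leP phi s : dnorm_le phi (ofR s) <-> bounded_by phi s.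
Proof.
split=> h f t Cf.
  move=> t0 ft; rewrite -(ofR_le S) rmorphM -(normE S); apply: h => //.
  by split=> [|w]; rewrite ?ofR_ge0 // (normE S) ofR_le.
move=> [t0 ft]; rewrite (ge0_ofR S t0) -rmorphM norm_le_ofR; apply: h => //.
  exact: nrm_ge0.
by move=> w; rewrite -(ofR_le S) -(normE S) -ge0_ofR.
Qed.

Lemma dnorm_le_ge0 phi s : dnorm_le phi s -> 0 <= s.
Proof.
move=> /(_ (fun=> 0) 1 (C0_zero S Omega)); rewrite mulr1 => h.
apply: le_trans (h _); first exact: normr_ge0.
by split=> // w; rewrite normr0.
Qed.

Lemma is_dualP phi : is_dual phi <-> lin_on_C0 phi /\ exists2 s, 0 <= s & bounded_by phi s.
Proof.
split=> -[phil [s]].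
  move=> hs; split=> //; exists (nrm s); first exact: nrm_ge0.
  by apply/dnorm_leP; rewrite -ge0_ofR //; exact: dnorm_le_ge0 hs.
by move=> s0 hs; split=> //; exists (ofR s); apply/dnorm_leP.
Qed.

Lemma bidual_bounded Phi : is_bidual Phi -> exists2 C : R, 0 <= C &
  forall phi s, lin_on_C0 phi -> 0 <= s -> bounded_by phi s -> nrm (Phi phi) <= C * s.
Proof.
move=> [_ [C hC]].
have lin_zero : lin_on_C0 (fun _ : Omega -> K => 0 : K).
  by move=> a f g _ _; rewrite mulr0 addr0.
have C0 : 0 <= C.
  have := hC (fun=> 0) 1; rewrite mulr1 => h.
  apply: le_trans (h _ _ _); [exact: normr_ge0| |exact: ler01|].
    by split=> //; exists 1 => f t _ [t0 _]; rewrite normr0 mul1r.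
  by move=> f t _ [t0 _]; rewrite normr0 mul1r.
exists (nrm C) => [|phi s phil s0 hs]; first exact: nrm_ge0.
rewrite -(ofR_le S) rmorphM -(normE S) -ge0_ofR //; apply: hC.
- by apply/is_dualP; split=> //; exists s.
- by rewrite ofR_ge0.
- exact/dnorm_leP.
Qed.

Definition re_form phi (x : X) : R := re (phi (sval x)).

Lemma re_form_linear phi : lin_on_C0 phi -> linear_form (re_form phi).
Proof.
move=> phil a x y; rewrite /re_form /= phil; try exact: svalP.
by rewrite reD reZ.
Qed.

(* The [K]-linear functional with a given real part: [u x - i u (i x)]. *)
Definition complexify (u : X -> R) (f : Omega -> K) : K :=
  ofR (u (toC0 f)) - jj * ofR (u (toC0 (fun w => jj * f w))).

Lemma linear_form0 (u : X -> R) : linear_form u -> u 0 = 0.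
Proof. by move=> ul; have := ul 1 0 0; rewrite scale1r addr0; lra. Qed.

(** Real linearity and commutation with [jj] suffice, since every scalar is a real combination of
    [1] and [jj]. Commutation uses [jj * jj = -1], or is trivial when [jj = 0]. *)
Lemma complexify_lin u : linear_form u -> lin_on_C0 (complexify u).
Proof.
move=> ul.
have clin a f g : C0 f -> C0 g ->
    complexify u (fun w => ofR a * f w + g w) = ofR a * complexify u f + complexify u g.
  move=> Cf Cg; rewrite /complexify toC0_lin // ul.
  rewrite (_ : (fun w => jj * _) = fun w => ofR a * (jj * f w) + jj * g w); last first.
    by apply/funext => w; ring.
  by rewrite toC0_lin ?ul; try exact: (C0_scale S); rewrite !rmorphD !rmorphM; ring.
have cjj f : C0 f -> complexify u (fun w => jj * f w) = jj * complexify u f.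
  move=> Cf; rewrite /complexify.
  have [j0|j1] := jj_cases S.
    rewrite j0 !mul0r subr0.
    rewrite (_ : toC0 _ = 0) ?linear_form0 ?rmorph0 //.
    by apply: C0space_eq => w; rewrite toC0K; [rewrite mul0r|exact: (C0_scale S)].
  have -> : toC0 (fun w => jj * (jj * f w)) = (-1) *: toC0 f + 0.
    apply: C0space_eq => w; rewrite toC0K /=; last by do 2 apply: (C0_scale S).
    by rewrite toC0K // mulrA j1 rmorphN rmorph1 addr0.
  by rewrite ul linear_form0 // addr0 mulN1r rmorphN mulrBr mulrA j1; ring.
move=> a f g Cf Cg.
have Cjf := C0_scale S jj Cf.
rewrite {1}(re_decomp S a) [in RHS](re_decomp S a).
set al := re a; set be := re (jj * a).
rewrite (_ : (fun w => _) = fun w => ofR al * f w + (ofR (- be) * (jj * f w) + g w)).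
  rewrite clin //; last exact: (C0_lin S).
  by rewrite clin // cjj // rmorphN; ring.
by apply/funext => w; rewrite rmorphN; ring.
Qed.

Lemma re_complexify u f : re (complexify u f) = u (toC0 f).
Proof. by rewrite /complexify -mulrN -rmorphN reD re_ofR re_jj addr0. Qed.

Lemma complexify_re phi f : lin_on_C0 phi -> C0 f -> complexify (re_form phi) f = phi f.
Proof.
move=> phil Cf; rewrite /complexify /re_form !toC0K //; last exact: (C0_scale S).
by rewrite linZ // -re_decomp.
Qed.

(** * Bidual elements on an order interval *)

Section Interval.
Variable lam : (Omega -> R) -> R.
Hypothesis lamP : positive_functional lam.

Definition order_interval : set ((Omega -> K) -> K) :=
  [set psi | lin_on_C0 psi /\
    forall f, C0 f -> nrm (psi f) <= lam (fun w => nrm (f w))].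

(** The last inequality is Cauchy-Schwarz against the constant function [1]. As [1] need not vanish
    at infinity, it is replaced by elements of [C_0] that stay below it. *)
Lemma lam_nrm_bound : exists2 L, 0 <= L &
  (forall f t, C0 f -> 0 <= t -> (forall w, nrm (f w) <= t) ->
    lam (fun w => nrm (f w)) <= L * t /\ lam (fun w => nrm (f w) ^+ 2) <= L * t ^+ 2) /\
  (forall f, C0 f -> lam (fun w => nrm (f w)) ^+ 2 <= L * lam (fun w => nrm (f w) ^+ 2)).
Proof.
have [_ _ _ [L L0 hL]] := lamP; exists L => //; split.
  move=> f t Cf t0 ft; split; apply: hL => //; first exact: cone_nrm.
  - exact: cone_nrm2.
  - exact: sqr_ge0.
  - by move=> w; rewrite ler_sqr ?nnegrE ?nrm_ge0.
move=> f Cf; rewrite mulrC.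
have cu := cone_nrm S Cf; have cu2 := cone_nrm2 S Cf.
set u := (fun w => nrm (f w)) in cu *; set u2 := (fun w => _) in cu2 *.
have l0 := lam_ge0 lamP cu; have l20 := lam_ge0 lamP cu2.
apply: discriminant_le => // s.
have [s0|s0] := leP s 0; first by have := sqr_ge0 s; nra.
(* Since [v = 1 - (s u - 1)^2], its positive part is at most [1], so [lam] takes there a value at
   most [L]; this yields the nonnegative quadratic in [s]. *)
pose v := fun w => 2 * s * u w - s ^+ 2 * u2 w.
have Cv : C0 v by apply: C0_sub; apply: C0_mulr; [exact: cu.1|exact: cu2.1].
have s20 : 0 <= 2 * s by lra.
have cvp := cone_pospart Cv.
have : lam (fun w => 2 * s * u w) <= lam (fun w => pospart v w + s ^+ 2 * u2 w).
  apply: lam_mono => //; [exact: coneZ| |].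
    by apply: coneD => //; apply: coneZ => //; exact: sqr_ge0.
  by move=> w; rewrite /pospart; have := ler_norm (v w); rewrite {1 4}/v; lra.
rewrite lamD // ?lamZ ?sqr_ge0 //; last by apply: coneZ => //; exact: sqr_ge0.
have : lam (pospart v) <= L * 1.
  apply: hL => // w; rewrite /pospart.
  have v1 : v w <= 1.
    by rewrite /v /u2 /u; have := sqr_ge0 (s * nrm (f w) - 1); nra.
  by have [v0|v0] := leP 0 (v w); [rewrite ger0_norm|rewrite ltr0_norm]; lra.
by lra.
Qed.

Lemma nrm_phase t f w : nrm t = 1 -> nrm (t * f w) = nrm (f w).
Proof. by move=> t1; rewrite nrmM t1 mul1r. Qed.

Lemma inner_phase t f : nrm t = 1 -> C0 f ->
  C0_inner lam (toC0 (fun w => t * f w)) (toC0 (fun w => t * f w)) =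
  lam (fun w => nrm (f w) ^+ 2).
Proof.
move=> t1 Cf; rewrite C0_innerE // toC0K; last exact: (C0_scale S).
by congr lam; apply/funext => w; rewrite nrm_phase.
Qed.

(* Hilbert space argument: on the order interval, functionals are bounded for
   the seminorm of [L^2(lam)], hence both they (first use of [riesz_approx]) and
   the restriction of [Phi] (second use) are represented by elements of [C_0]. *)
Lemma bidual_approx Phi : is_bidual Phi -> forall eps, 0 < eps ->
  exists2 f, C0 f & forall psi, order_interval psi -> nrm (Phi psi - psi f) <= eps.
Proof.
move=> PhiP eps eps0.
have [Philin _] := PhiP; have [C Cge0 PhiC] := bidual_bounded PhiP.
have [L L0 [Lbd LCS]] := lam_nrm_bound.
have BP := C0_semi_inner S lamP; have [Bsym Blin Bpos] := BP.
pose B := C0_inner lam : X -> X -> R.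
(* Boundedness for the seminorm of [L^2(lam)] implies boundedness for the sup norm, because
   [B x x <= L * t ^+ 2] whenever [x] is bounded by [t]. *)
have B2 u q : linear_form u -> (forall x, u x ^+ 2 <= q * B x x) -> 0 <= q ->
    bounded_by (complexify u) (Num.sqrt (L * q)).
  move=> ul uq q0 f t Cf t0 ft.
  have [th th1 <-] := lin_phase (complexify_lin ul) Cf.
  rewrite re_complexify; apply: le_trans (ler_norm _) _.
  rewrite -(@ler_pXn2r _ 2) ?nnegrE ?mulr_ge0 ?sqrtr_ge0 //.
  rewrite real_normK ?num_real // exprMn sqr_sqrtr ?mulr_ge0 //.
  apply: le_trans (uq _) _; rewrite /B inner_phase // [L * q]mulrC -mulrA ler_wpM2l //.
  exact: (Lbd f t Cf t0 ft).2.
(* [m] is [Phi] on the functionals represented by elements of [C_0]. Its approximate representer [x]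
   depends on [Phi] and [eps] alone. *)
pose m y : R := re (Phi (complexify (B y))).
have dualB y : is_dual (complexify (B y)).
  apply/is_dualP; split; first exact: complexify_lin.
  exists (Num.sqrt (L * B y y)); first exact: sqrtr_ge0.
  apply: B2 => // x; exact: semi_inner_CS BP y x.
have mlin : linear_form m.
  move=> a y z; rewrite /m -reZ -reD -Philin //; congr (re (Phi _)).
  have Bl h : B (a *: y + z) h = a * B y h + B z h by rewrite /B !(Bsym _ h) Blin.
  apply/funext => f; rewrite /complexify !Bl.
  move: (B y _) (B z _) (B y _) (B z _) => b1 b2 b3 b4.
  by rewrite !rmorphD !rmorphM; ring.
have mbd y : m y ^+ 2 <= C ^+ 2 * L * B y y.
  have := PhiC _ _ (complexify_lin (Blin y)) (sqrtr_ge0 (L * B y y))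
    (B2 _ _ (Blin y) (semi_inner_CS BP y) (Bpos y)).
  move=> h; rewrite -real_normK ?num_real // -mulrA.
  rewrite -[L * _]sqr_sqrtr ?mulr_ge0 // -exprMn.
  rewrite ler_sqr ?nnegrE ?mulr_ge0 ?sqrtr_ge0 //.
  exact: le_trans (re_le_nrm S _) h.
have eps2 : 0 < (eps / 3) ^+ 2 by rewrite exprn_gt0 // divr_gt0.
(* [2 + 2 * L] will bound [B y y] for the representer [y] of any [psi] in the interval, see
   [Byy]. *)
have eta0 : 0 < (eps / 3) ^+ 2 / (2 + 2 * L) by apply: divr_gt0 => //; lra.
have [x xm] := riesz_approx BP mlin mbd eta0.
exists (sval x); first exact: svalP x.
(* [C ^+ 2 * L] is needed for the estimate [t1] and [B x x] for [t3]; the summand [1] keeps [D]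
   positive. *)
pose D := 1 + C ^+ 2 * L + B x x.
have CL0 : 0 <= C ^+ 2 * L by rewrite mulr_ge0 // sqr_ge0.
have D1 : 1 <= D by have := Bpos x; rewrite /D /B; lra.
pose eta' := Num.min 1 ((eps / 3) ^+ 2 / D).
have eta'0 : 0 < eta' by rewrite lt_min ltr01 divr_gt0 //; lra.
have eta'1 : eta' <= 1 by rewrite ge_min lexx.
have eta'D : eta' * D <= (eps / 3) ^+ 2.
  by rewrite -ler_pdivlMr ?ge_min ?lexx ?orbT //; lra.
(* The interval is stable under scalars of modulus one, so bounding real parts is enough. *)
suff key psi : order_interval psi -> re (Phi psi - psi (sval x)) <= eps.
  move=> psi [psil psib].
  have [th th1 <-] := re_phase S (Phi psi - psi (sval x)).
  have th_int : order_interval (fun f => th * psi f + 0).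
    split=> [a f g Cf Cg|f Cf]; first by rewrite psil //; ring.
    by rewrite addr0 nrmM th1 mul1r psib.
  have zdual : is_dual (fun _ : Omega -> K => 0 : K).
    by split=> [a f g _ _|]; [ring|exists 0 => f t _ [t0 _]; rewrite normr0 mul0r].
  have pdual : is_dual psi.
    apply/is_dualP; split=> //; exists L => // f t Cf t0 ft.
    exact: le_trans (psib f Cf) (Lbd f t Cf t0 ft).1.
  have := key _ th_int; rewrite Philin // addr0.
  suff -> : Phi (fun=> 0) = 0 by rewrite addr0 mulrBr.
  have := Philin 1 _ _ zdual zdual.
  rewrite (_ : (fun f => _) = fun=> 0); last by apply/funext => f; ring.
  by move/eqP; rewrite mul1r -subr_eq0 opprD addrA subrr add0r oppr_eq0 => /eqP.
move=> [psil psib].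
have lpsi := re_form_linear psil.
have psi2 y : re_form psi y ^+ 2 <= L * B y y.
  rewrite /B C0_innerE //; apply: le_trans (LCS _ (svalP y)).
  rewrite -real_normK ?num_real // ler_sqr ?nnegrE ?lam_ge0 //; last first.
    exact: cone_nrm (svalP y).
  exact: le_trans (re_le_nrm S _) (psib _ (svalP y)).
have [y yp] := riesz_approx BP lpsi psi2 eta'0.
(* With [b = B y y] and [r = re_form psi y], one has [b^2 <= 2 (b - r)^2 + 2 r^2 <= 2 b + 2 L b],
   and [b] can be cancelled. *)
have Byy : B y y <= 2 + 2 * L.
  have := yp y; have := psi2 y; have := Bpos y; rewrite -/(B y y).
  have := sqr_ge0 (B y y - 2 * re_form psi y).
  set b := B y y; set r := re_form psi y; move=> h0 h1 h2 h3.
  have [b0|b0] := leP b 0; first lra.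
  have h4 : eta' * b <= b by rewrite ler_piMl // ltW.
  by rewrite -(ler_pM2l b0); nra.
pose v z := (-1) * B y z + re_form psi z.
have vl : linear_form v.
  by move=> a z z'; rewrite /v /B Blin lpsi; ring.
have v2 z : v z ^+ 2 <= eta' * B z z.
  rewrite (_ : v z ^+ 2 = (C0_inner lam y z - re_form psi z) ^+ 2); first exact: yp.
  by rewrite /v /B; ring.
pose chi f := (-1) * complexify (B y) f + psi f.
have chiE f : C0 f -> chi f = complexify v f.
  move=> Cf; rewrite /chi -(complexify_re psil Cf) /complexify /v.
  move: (B y _) (B y _) (re_form _ _) (re_form _ _) => b1 b2 b3 b4.
  by rewrite !rmorphD !rmorphM rmorphN rmorph1; ring.
have chil : lin_on_C0 chi.
  by move=> a f g Cf Cg; rewrite !chiE //; [exact: complexify_lin|exact: (C0_lin S)].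
have chib : bounded_by chi (Num.sqrt (L * eta')).
  by move=> f t Cf; rewrite chiE //; exact: B2 (ltW eta'0) _ _ Cf.
have pdual : is_dual psi.
  apply/is_dualP; split=> //; exists L => // f t Cf t0 ft.
  exact: le_trans (psib f Cf) (Lbd f t Cf t0 ft).1.
(* The real part of [Phi psi - psi x] is the sum of [re (Phi chi)], [m y - B x y] and
   [B y x - re_form psi x]; each is at most [eps / 3]. *)
have t1 : re (Phi chi) <= eps / 3.
  apply: le_trans (ler_norm _) (le_trans (re_le_nrm S _) _).
  apply: le_trans (PhiC _ _ chil (sqrtr_ge0 _) chib) _.
  rewrite -(@ler_pXn2r _ 2) ?nnegrE ?mulr_ge0 ?sqrtr_ge0 ?(ltW eps0) //.
  rewrite exprMn sqr_sqrtr ?mulr_ge0 ?(ltW eta'0) //.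
  apply: le_trans eta'D; rewrite mulrA mulrC ler_wpM2l ?(ltW eta'0) //.
  by have := Bpos x; rewrite /D /B; lra.
have t2 : m y - B x y <= eps / 3.
  apply: le_trans (ler_norm _) _.
  rewrite -(@ler_pXn2r _ 2) ?nnegrE ?divr_ge0 ?(ltW eps0) // real_normK ?num_real //.
  rewrite -sqrrN opprB; apply: le_trans (xm y) _.
  by rewrite mulrAC ler_pdivrMr ?ler_wpM2l ?(ltW eps2) //; lra.
have t3 : B y x - re_form psi x <= eps / 3.
  apply: le_trans (ler_norm _) _.
  rewrite -(@ler_pXn2r _ 2) ?nnegrE ?divr_ge0 ?(ltW eps0) // real_normK ?num_real //.
  apply: le_trans (yp x) (le_trans _ eta'D).
  by rewrite ler_wpM2l ?(ltW eta'0) // /D -/(B x x); lra.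
have Phichi : Phi chi = - Phi (complexify (B y)) + Phi psi.
  by rewrite Philin // mulN1r.
move: t1; rewrite reD reN -/(re_form psi x) Phichi reD reN -/(m y).
by have := Bsym x y; rewrite -/(B x y) -/(B y x); lra.
Qed.

End Interval.
End Functionals.

(** * Order intervals *)

Section OrderInterval.
Variables (R : realType) (K : numFieldType) (S : scalars R K).
Variable Omega : topologicalType.
Local Notation ofR := (ofR S).
Local Notation re := (re S).
Local Notation nrm := (nrm S).
Local Notation X := (C0space Omega S).
Local Notation toC0 := (toC0 S).
Implicit Types (phi psi : (Omega -> K) -> K) (f g : Omega -> K) (x y : X).

Variable lam : (Omega -> R) -> R.
Hypothesis lamP : positive_functional lam.
Local Notation interval := (order_interval S lam).

Lemma order_interval_dual psi : interval psi -> is_dual psi.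
Proof.
move=> [psil psib]; have [L L0 [Lbd _]] := lam_nrm_bound S lamP.
apply/(is_dualP S); split=> //; exists L => // f t Cf t0 ft.
exact: le_trans (psib f Cf) (Lbd f t Cf t0 ft).1.
Qed.

Lemma order_interval0 : interval (fun=> 0).
Proof.
split=> [a f g _ _|f Cf]; first by rewrite mulr0 addr0.
by rewrite nrm0 lam_ge0 //; exact: cone_nrm.
Qed.

(** Weak-star compactness of the interval, in the manner of Alaoglu: values at each element of [C_0]
    are bounded, and the defining conditions pass to pointwise limits. *)
Lemma order_interval_ultra_limit (T : Type) (G : set_system T)
    (F : T -> (Omega -> K) -> K) :
  UltraFilter G -> G [set t | interval (F t)] ->
  exists2 psi, interval psi &
    forall f, C0 f -> forall e, 0 < e -> G [set t | nrm (F t f - psi f) < e].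
Proof.
move=> GU GF.
have lim_ex f : exists l : K, C0 f -> F t f @[t --> G] --> l.
  have [Cf|nCf] := pselect (C0 f); last by exists 0.
  have [|l Fl] := @ultra_bounded_cvg_scalar R K S T G (fun t => F t f)
    (lam (fun w => nrm (f w))) GU; last by exists l.
  by apply: filterS GF => t [_]; apply.
have [psi psiP] := choice lim_ex.
have near_psi f e : C0 f -> 0 < e -> G [set t | nrm (F t f - psi f) < e].
  move=> Cf e0; have e0' : 0 < ofR e by rewrite ofR_gt0.
  have /cvgrPdist_lt/(_ _ e0') := psiP f Cf.
  by apply: filterS => t; rewrite norm_lt_ofR nrmBC.
exists psi => [|f Cf e e0]; last exact: near_psi.
split=> [a f g Cf Cg|f Cf].
  have h1 := psiP _ (C0_lin S a Cf Cg).
  have h2 : F t (fun w => a * f w + g w) @[t --> G] --> a * psi f + psi g.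
    apply: cvg_trans (cvgD (cvgMr (psiP f Cf)) (psiP g Cg)).
    apply: near_eq_cvg; apply: filterS GF => t [Fl _] /=.
    by rewrite Fl.
  exact: (cvg_unique _ h1 h2).
apply/ler_addgt0Pr => e e0.
have [t [/= [_ Ft] Fpsi]] := filter_ex (filterI GF (near_psi f e Cf e0)).
have := nrmD S (psi f - F t f) (F t f); rewrite subrK nrmBC.
by have := Ft f Cf; lra.
Qed.

(** Without a finite subcover, the sets left uncovered by finite subfamilies generate a proper
    filter. An ultrafilter refining it converges weak-star to some [psi] in the interval, and
    [bidual_approx] upgrades this to weak convergence; so the member of the cover around [psi] lies
    in the ultrafilter, as does its complement. *)
Lemma order_interval_wcompact : wcompact interval.
Proof.
split=> [psi|I U Uo Ucov]; first exact: order_interval_dual.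
apply: contrapT => nofin.
pose D n (h : 'I_n -> I) := [set phi | interval phi /\ forall j, ~ U (h j) phi].
pose F := [set A | exists n (h : 'I_n -> I), D n h `<=` A].
have FF : ProperFilter F.
  apply: Build_ProperFilter_ex.
    move=> A [n [h hA]]; apply: contrapT => nA; apply: nofin; exists n, h => phi iphi.
    apply: contrapT => nU; apply: nA; exists phi; apply: hA; split=> // j Uj.
    by apply: nU; exists j.
  split.
  - by exists 0%N, (fun j : 'I_0 => match j with Ordinal _ p => False_rect _ (notF p) end).
  - move=> A B [n1 [h1 hA]] [n2 [h2 hB]].
    exists (n1 + n2)%N, (fun k => match fintype.split k with inl a => h1 a | inr b => h2 b end).
    move=> phi [iphi nU]; split; [apply: hA|apply: hB]; split=> // j.
      by have := nU (lshift n2 j); rewrite (unsplitK (inl j)).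
    by have := nU (rshift n1 j); rewrite (unsplitK (inr j)).
  - by move=> A B AB [n [h hA]]; exists n, h; exact: subset_trans AB.
have [G [GU FG]] := ultraFilterLemma FF.
have Gint : G interval.
  apply: FG; exists 0%N.
  by exists (fun j : 'I_0 => match j with Ordinal _ p => False_rect _ (notF p) end) => phi [].
have [psi ipsi Gpsi] := order_interval_ultra_limit (F := id) GU Gint.
have [i Ui] := Ucov psi ipsi.
have [n [Phi [e [e0 PhiP eU]]]] := Uo i psi Ui (order_interval_dual ipsi).
have e3 : 0 < nrm e / 3 by rewrite divr_gt0 // nrm_gt0.
have GPhi j : G [set phi | `|Phi j phi - Phi j psi| < e].
  have [f Cf fP] := bidual_approx S lamP (PhiP j) e3.
  apply: filterS (filterI Gint (Gpsi f Cf _ e3)) => phi [/= iphi phif].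
  rewrite (ge0_ofR S (ltW e0)) norm_lt_ofR.
  have := fP phi iphi; have := fP psi ipsi.
  have := nrmB S ((Phi j phi - phi f) + (phi f - psi f)) (Phi j psi - psi f).
  have := nrmD S (Phi j phi - phi f) (phi f - psi f).
  rewrite (_ : _ - (Phi j psi - psi f) = Phi j phi - Phi j psi); last by ring.
  by lra.
have GUi : G (U i).
  have GPhi_all : G [set phi | forall j, `|Phi j phi - Phi j psi| < e] by exact: filter_forall GPhi.
  apply: filterS (filterI Gint GPhi_all) => phi [iphi h].
  exact: eU (order_interval_dual iphi) h.
have GnUi : G (~` U i).
  apply: FG; exists 1%N, (fun=> i) => phi [_ nU] /=; exact: (nU ord0).
by have [phi [? nU]] := filter_ex (filterI GUi GnUi); apply: nU.
Qed.

(* Hahn-Banach applied to the infimal convolution of [lam |f|] and [d ||f||],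
   shifted by [phi]. *)
Lemma order_interval_split phi d : 0 <= d -> lin_on_C0 phi ->
  (forall f t, C0 f -> 0 <= t -> (forall w, nrm (f w) <= t) ->
    nrm (phi f) <= lam (fun w => nrm (f w)) + d * t) ->
  exists2 psi, interval psi & bounded_by S (fun f => phi f - psi f) d.
Proof.
move=> d0 phil phib.
pose p x := lam (fun w => nrm (sval x w)).
have pD x y : p (x + y) <= p x + p y.
  rewrite /p -lamD //; try exact: cone_nrm (svalP _).
  apply: lam_mono => //; first exact: cone_nrm (svalP (x + y)).
    by apply: coneD; exact: cone_nrm (svalP _).
  by move=> w; exact: nrmD.
have pZ a x : 0 <= a -> p (a *: x) = a * p x.
  move=> a0; rewrite /p -lamZ //; last exact: cone_nrm (svalP x).
  by congr lam; apply/funext => w /=; rewrite nrmM nrm_ofR.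
have pN x : p (- x) = p x.
  by congr lam; apply/funext => w /=; rewrite mulN1r nrmN.
have rl : linear_form (re_form phi : X -> R) by exact: re_form_linear.
have rl0 : re_form phi (0 : X) = 0 := linear_form0 rl.
(* Here [t] plays the role of the sup norm of [y]. The hypothesis on [phi] is exactly what bounds
   [E x] from below, by [- p x]. *)
pose E x := [set r | exists y t, [/\ 0 <= t, forall w, nrm (sval y w) <= t &
  r = p (x + y) + d * t - re_form phi y]].
have Elb x : lbound (E x) (- p x).
  move=> _ [y [t [t0 yt ->]]].
  have := phib _ _ (svalP y) t0 yt; rewrite -/(p y).
  have := re_le_nrm S (phi (sval y)); have := ler_norm (re_form phi y).
  rewrite /re_form; have := pD (x + y) (- x); rewrite pN addrAC subrr add0r.
  by lra.
have bd0 w : nrm (sval (0 : X) w) <= 0 by rewrite /= nrm0.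
have E0 x : E x (p x).
  by exists 0, 0; split=> //; rewrite addr0 mulr0 rl0 subr0 addr0.
have infE x : has_inf (E x) by split; [exists (p x)|exists (- p x)].
have Einf x r : E x r -> inf (E x) <= r by move=> Er; apply: ge_inf => //; exact: (infE x).2.
have ED x y r s : E x r -> E y s -> exists2 q, E (x + y) q & q <= r + s.
  move=> [x' [t [t0 xt ->]]] [y' [t' [t'0 yt ->]]].
  exists (p ((x + y) + (x' + y')) + d * (t + t') - re_form phi (x' + y')).
    exists (x' + y'), (t + t'); split=> //; first exact: addr_ge0.
    by move=> w; apply: le_trans (nrmD S _ _) _; exact: lerD.
  have := rl 1 x' y'; rewrite scale1r mul1r addrACA => ->.
  by have := pD (x + x') (y + y'); lra.
have EZ a x r : 0 < a -> E x r -> E (a *: x) (a * r).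
  move=> a0 [y [t [t0 yt ->]]]; exists (a *: y), (a * t); split.
  - by rewrite mulr_ge0 // ltW.
  - by move=> w /=; rewrite nrmM nrm_ofR ?(ltW a0) // ler_wpM2l // ltW.
  - have := rl a y 0; rewrite !addr0 rl0 addr0 -scalerDr pZ ?(ltW a0) // => ->.
    by ring.
have [|u ul uq] := @hahn_banach_sublinear R X (fun x => inf (E x)).
  split=> [x y|a x].
    apply/ler_addgt0Pr => e e0; have e20 : 0 < e / 2 by rewrite divr_gt0.
    have [r Er l1] := inf_adherent e20 (infE x).
    have [s Es l2] := inf_adherent e20 (infE y).
    by have [q Eq qrs] := ED _ _ _ _ Er Es; have := Einf _ _ Eq; lra.
  rewrite le_eqVlt => /predU1P[<-|a0].
    rewrite scale0r mul0r; apply/eqP; rewrite eq_le; apply/andP; split.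
      by have := Einf 0 _ (E0 0); rewrite -{2}(scale0r (0 : X)) pZ // mul0r.
    apply: lb_le_inf; first by exists (p 0).
    by move=> r /Elb; rewrite -{1}(scale0r (0 : X)) pZ // mul0r oppr0.
  apply/eqP; rewrite eq_le; apply/andP; split.
    rewrite -ler_pdivrMl //; apply: lb_le_inf; first by exists (p x).
    by move=> r Er; rewrite ler_pdivrMl //; apply: Einf; exact: EZ.
  apply: lb_le_inf; first by exists (p (a *: x)).
  move=> r Er; rewrite -ler_pdivlMl //; apply: Einf.
  have := EZ a^-1 _ _ _ Er; rewrite scalerA mulVf ?gt_eqF // scale1r.
  by apply; rewrite invr_gt0.
have upsi := complexify_lin ul.
(* Two choices in the infimum give the two conclusions: [y = 0] at [x] puts [u] below [p], and
   [y = g] at [- g] bounds the real part of [phi g] minus [u g] by [d * t]. *)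
exists (complexify u).
  split=> // f Cf; have [t t1 <-] := lin_phase S upsi Cf.
  rewrite re_complexify; apply: le_trans (uq _) (le_trans (Einf _ _ (E0 _)) _).
  rewrite /p toC0K; last exact: (C0_scale S).
  by rewrite (_ : (fun w => _) = fun w => nrm (f w)) //;
     apply/funext => w; rewrite nrm_phase.
move=> f t Cf t0 ft.
have [th th1 <-] := lin_phase S (lin_sub phil upsi) Cf.
set g := fun w => th * f w; have Cg : C0 g by exact: (C0_scale S).
rewrite reD reN re_complexify.
have gt w : nrm (sval (toC0 g) w) <= t by rewrite toC0K // nrm_phase.
have := uq (- toC0 g).
have : E (- toC0 g) (d * t - re (phi g)).
  exists (toC0 g), t; split=> //; rewrite addNr /re_form toC0K // {1}/p.
  rewrite (_ : (fun w => _) = fun=> 0) ?lam0 ?add0r //.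
  by apply/funext => w /=; rewrite nrm0.
move=> /Einf h1 h2; have h3 := ul (-1) (toC0 g) 0.
by rewrite scaleN1r addr0 linear_form0 // in h3; lra.
Qed.

End OrderInterval.

(** * Domination by a positive functional *)

Section Variation.
Variables (R : realType) (K : numFieldType) (S : scalars R K).
Variable Omega : topologicalType.
Local Notation ofR := (ofR S).
Local Notation nrm := (nrm S).
Implicit Types (phi psi : (Omega -> K) -> K) (f g : Omega -> K) (u v : Omega -> R).

Lemma C0_mul_continuous (s : Omega -> R) f : continuous s ->
  (forall w, 0 <= s w <= 1) -> C0 f -> C0 (fun w => ofR (s w) * f w).
Proof.
move=> sc s01 Cf; apply: (C0_dom (S := S) _ (C0_nrm S Cf)).
  move=> w; apply: cvgM; last exact: (C0_continuous S).
  by apply: (continuous_comp (sc w)); exact: ofR_continuous.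
move=> w; have /andP[s0 s1] := s01 w.
by rewrite nrmM nrm_ofR // ler_piMl // nrm_ge0.
Qed.

(* On the cone of nonnegative functions, the total variation [|phi|]. *)
Definition variation phi u : R :=
  sup [set r | exists2 f, C0 f /\ (forall w, nrm (f w) <= u w) & r = nrm (phi f)].

Variables (phi : (Omega -> K) -> K) (M : R).
Hypotheses (phil : lin_on_C0 phi) (M0 : 0 <= M) (phiM : bounded_by S phi M).
Local Notation V := (variation phi).

Let Vset u := [set r | exists2 f, C0 f /\ (forall w, nrm (f w) <= u w) & r = nrm (phi f)].

Lemma variation_has_sup u : cone u -> has_sup (Vset u).
Proof.
move=> [Cu u0]; split.
  by exists (nrm (phi (fun=> 0))), (fun=> 0) => //; split=> [|w]; [exact: (C0_zero S)|rewrite nrm0].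
have [t t0 ut] := C0_bounded (real_scalars R) Cu.
exists (M * t) => _ [f [Cf fu] ->]; apply: phiM => //; first exact: ltW.
by move=> w; apply: le_trans (fu w) (le_trans (ler_norm _) (ut w)).
Qed.

Lemma variation_ge u f : cone u -> C0 f -> (forall w, nrm (f w) <= u w) -> nrm (phi f) <= V u.
Proof.
by move=> cu Cf fu; apply: ub_le_sup; [exact: (variation_has_sup cu).2|exists f].
Qed.

Lemma variation_le u r : cone u ->
  (forall f, C0 f -> (forall w, nrm (f w) <= u w) -> nrm (phi f) <= r) -> V u <= r.
Proof.
move=> cu h; apply: ge_sup; first exact: (variation_has_sup cu).1.
by move=> _ [f [Cf fu] ->]; exact: h.
Qed.

Lemma variation_ge0 u : cone u -> 0 <= V u.
Proof.
move=> cu; apply: le_trans (nrm_ge0 S (phi (fun=> 0))) _.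
by apply: variation_ge => // [|w]; [exact: (C0_zero S)|rewrite nrm0 cu.2].
Qed.

(** Competitors for [u] and [v] are rotated so that [phi] is real and nonnegative on both; their sum
    competes for [u + v]. *)
Lemma variation_superadd u v : cone u -> cone v -> V u + V v <= V (fun w => u w + v w).
Proof.
move=> cu cv; rewrite -lerBrDr; apply: variation_le => // f Cf fu.
rewrite lerBrDr addrC -lerBrDr; apply: variation_le => // g Cg gv; rewrite lerBrDr.
have [a a1 <-] := lin_phase S phil Cg; have [b b1 <-] := lin_phase S phil Cf.
have Caf := C0_scale S b Cf; have Cag := C0_scale S a Cg.
rewrite -reD -linD //; apply: le_trans (ler_norm _) (le_trans (re_le_nrm S _) _).
apply: variation_ge; [exact: coneD|exact: (C0D S)|move=> w].
apply: le_trans (nrmD S _ _) _; rewrite !nrm_phase // addrC.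
exact: lerD.
Qed.

(** Riesz decomposition: [f] is cut in the proportions [u : v : h]. The constant [h > 0] keeps the
    denominator [u + v + h] away from zero, and [h = e / (M + 1)] makes the third piece cost at most
    [e]. *)
Lemma variation_subadd u v : cone u -> cone v -> V (fun w => u w + v w) <= V u + V v.
Proof.
move=> cu cv; have [u0 v0] := (cu.2, cv.2).
apply: variation_le; first exact: coneD.
move=> f Cf fuv; apply/ler_addgt0Pr => e e0.
have M1 : 0 < M + 1 by rewrite ltr_wpDl.
pose h := e / (M + 1); have h0 : 0 < h by rewrite divr_gt0.
pose d w := u w + v w + h.
have d0 w : 0 < d w by rewrite /d; have := u0 w; have := v0 w; lra.
have uc : continuous u by exact: (C0_continuous (real_scalars R) cu.1).
have vc : continuous v by exact: (C0_continuous (real_scalars R) cv.1).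
have dc : continuous d.
  by move=> w; apply: cvgD; [apply: cvgD; [exact: uc|exact: vc]|exact: cvg_cst].
have part (s : Omega -> R) : continuous s -> (forall w, 0 <= s w <= d w) ->
    C0 (fun w => ofR (s w / d w) * f w) /\
    forall w, nrm (ofR (s w / d w) * f w) <= s w.
  move=> sc sd; split.
    apply: C0_mul_continuous => // [w|w].
      by apply: cvgM; [exact: sc|apply: cvgV; [rewrite gt_eqF|exact: dc]].
    by have /andP[s0 s1] := sd w; rewrite divr_ge0 ?(ltW (d0 w)) //= ler_pdivrMr ?mul1r.
  move=> w; have /andP[s0 s1] := sd w.
  rewrite nrmM nrm_ofR ?divr_ge0 ?(ltW (d0 w)) // mulrAC ler_pdivrMr //.
  by rewrite ler_wpM2l //; apply: le_trans (fuv w) _; rewrite /d; lra.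
have d_u w : 0 <= u w <= d w by rewrite /d; have := u0 w; have := v0 w; lra.
have d_v w : 0 <= v w <= d w by rewrite /d; have := u0 w; have := v0 w; lra.
have d_h w : 0 <= h <= d w by rewrite /d; have := u0 w; have := v0 w; lra.
have [C1 b1] := part u uc d_u.
have [C2 b2] := part v vc d_v.
have [C3 b3] := part (fun=> h) (@cst_continuous _ _ h) d_h.
have -> : f = fun w => (ofR (u w / d w) * f w + ofR (v w / d w) * f w) +
    ofR (h / d w) * f w.
  apply/funext => w; rewrite -!mulrDl -!rmorphD -!mulrDl -/(d w).
  by rewrite divff ?gt_eqF // rmorph1 mul1r.
rewrite linD ?linD //; last exact: (C0D S).
have := variation_ge cu C1 b1; have := variation_ge cv C2 b2.
have := phiM C3 (ltW h0) b3.
have : M * h <= e by rewrite /h mulrA ler_pdivrMr //; nra.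
have := nrmD S (phi (fun w => ofR (u w / d w) * f w) + phi (fun w => ofR (v w / d w) * f w))
  (phi (fun w => ofR (h / d w) * f w)).
have := nrmD S (phi (fun w => ofR (u w / d w) * f w)) (phi (fun w => ofR (v w / d w) * f w)).
lra.
Qed.

Lemma variation_scale_le a u : 0 < a -> cone u -> V (fun w => a * u w) <= a * V u.
Proof.
move=> a0 cu; apply: variation_le; first by apply: coneZ => //; exact: ltW.
move=> f Cf fau; rewrite -ler_pdivrMl // -(nrm_ofR S (a := a^-1)) ?invr_ge0 ?(ltW a0) //.
rewrite -nrmM -(linZ S) //; apply: variation_ge => // [|w]; first exact: (C0_scale S).
by rewrite nrmM nrm_ofR ?invr_ge0 ?(ltW a0) // ler_pdivrMl.
Qed.

Lemma variation_positive : positive_functional V.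
Proof.
split.
- exact: variation_ge0.
- move=> u v cu cv; apply/eqP; rewrite eq_le variation_subadd //=.
  exact: variation_superadd.
- move=> a u; rewrite le_eqVlt => /predU1P[<- cu|a0 cu].
    rewrite mul0r; apply/eqP; rewrite eq_le variation_ge0 ?andbT //; last exact: coneZ.
    apply: variation_le => [|f Cf f0]; first exact: coneZ.
    have := phiM Cf (lexx 0); rewrite mulr0; apply => w.
    by have := f0 w; rewrite mul0r.
  apply/eqP; rewrite eq_le variation_scale_le //=.
  have ca := coneZ (ltW a0) cu.
  rewrite -ler_pdivlMl //; have := variation_scale_le (a := a^-1) _ ca.
  rewrite invr_gt0 => /(_ a0); rewrite (_ : (fun w => _) = u) //.
  by apply/funext => w; rewrite mulKf // gt_eqF.
- exists M => // u t cu t0 ut; apply: variation_le => // f Cf fu.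
  by apply: phiM => // w; exact: le_trans (ut w).
Qed.

End Variation.

(** * Sums and ultralimits of positive functionals *)

Section UltraLimitFunctional.
Variables (R : realType) (Omega : topologicalType).

Lemma positive_functionalZ a (lam : (Omega -> R) -> R) : 0 <= a ->
  positive_functional lam -> positive_functional (fun u => a * lam u).
Proof.
move=> a0 lamP; have [h1 h2 h3 [L L0 h4]] := lamP; split.
- by move=> u cu; rewrite mulr_ge0 // h1.
- by move=> u v cu cv; rewrite h2 // mulrDr.
- by move=> c u c0 cu; rewrite h3 // mulrCA.
- exists (a * L) => [|u t cu t0 ut]; first exact: mulr_ge0.
  by rewrite -mulrA ler_wpM2l // h4.
Qed.

Lemma positive_functionalD (lam mu : (Omega -> R) -> R) :
  positive_functional lam -> positive_functional mu ->
  positive_functional (fun u => lam u + mu u).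
Proof.
move=> [h1 h2 h3 [L L0 h4]] [k1 k2 k3 [L' L'0 k4]]; split.
- by move=> u cu; rewrite addr_ge0 ?h1 ?k1.
- by move=> u v cu cv; rewrite h2 // k2 // addrACA.
- by move=> c u c0 cu; rewrite h3 // k3 // mulrDr.
- exists (L + L') => [|u t cu t0 ut]; first exact: addr_ge0.
  by rewrite mulrDl lerD // ?h4 ?k4.
Qed.

Lemma positive_functional0 : positive_functional (fun _ : Omega -> R => 0 : R).
Proof.
split=> // [u v _ _|a u _ _|]; [by rewrite addr0|by rewrite mulr0|].
by exists 0 => // u t _ _ _; rewrite mul0r.
Qed.

(** The common mass bound [M] makes the limit exist at every function of the cone, and it is
    inherited by the limit. *)
Lemma positive_functional_ultra_limit (T : Type) (G : set_system T)
    (W : T -> (Omega -> R) -> R) (M : R) :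
  UltraFilter G -> 0 <= M ->
  G [set t | positive_functional (W t) /\
     forall u s, cone u -> 0 <= s -> (forall w, u w <= s) -> W t u <= M * s] ->
  exists2 b, positive_functional b &
    forall u, cone u -> forall e, 0 < e -> G [set t | `|W t u - b u| < e].
Proof.
move=> GU M0 GW.
have lim_ex u : exists l : R, cone u -> W t u @[t --> G] --> l.
  have [cu|ncu] := pselect (cone u); last by exists 0.
  have [s s0 us] := C0_bounded (real_scalars R) cu.1.
  have [|l Wl] := @ultra_bounded_cvg T G R (fun t => W t u) (M * s) GU; last by exists l.
  apply: filterS GW => t [Wp WM] /=; rewrite ger0_norm; last by have [h _ _ _] := Wp; exact: h.
  by apply: WM => //; [exact: ltW|move=> w; exact: le_trans (ler_norm _) (us w)].
have [b bP] := choice lim_ex.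
have near_b u e : cone u -> 0 < e -> G [set t | `|W t u - b u| < e].
  move=> cu e0; have /cvgrPdist_lt/(_ _ e0) := bP u cu.
  by apply: filterS => t; rewrite distrC.
exists b => [|u cu e e0]; last exact: near_b.
split.
- move=> u cu; apply/ler_addgt0Pr => e e0.
  have [t [/= [[h _ _ _] _]]] := filter_ex (filterI GW (near_b u e cu e0)).
  by have := h u cu; rewrite ltr_norml; lra.
- move=> u v cu cv; apply: (cvg_unique _ (bP _ (coneD cu cv))) => //.
  apply: cvg_trans (cvgD (bP u cu) (bP v cv)).
  by apply: near_eq_cvg; apply: filterS GW => t [[_ h _ _] _] /=; rewrite h.
- move=> a u a0 cu; apply: (cvg_unique _ (bP _ (coneZ a0 cu))) => //.
  apply: cvg_trans (cvgMr (bP u cu)).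
  by apply: near_eq_cvg; apply: filterS GW => t [[_ _ h _] _] /=; rewrite h.
- exists M => // u s cu s0 us; apply/ler_addgt0Pr => e e0.
  have [t [/= [_ WM]]] := filter_ex (filterI GW (near_b u e cu e0)).
  by have := WM u s cu s0 us; rewrite ltr_norml; lra.
Qed.

End UltraLimitFunctional.

(** * Construction of the dominating functional *)

Section Domination.
Variables (R : realType) (K : numFieldType) (S : scalars R K).
Variable Omega : topologicalType.
Local Notation ofR := (ofR S).
Local Notation re := (re S).
Local Notation nrm := (nrm S).
Implicit Types (phi psi : (Omega -> K) -> K) (f g : Omega -> K) (u v : Omega -> R).

Variables (A : set ((Omega -> K) -> K)) (M : R).
Hypotheses (Alin : forall phi, A phi -> lin_on_C0 phi) (M0 : 0 <= M).
Hypothesis AM : forall phi, A phi -> bounded_by S phi M.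

(** Rotating each [x n] so that [psi] is nonnegative on it turns the sum of the [|psi (x n)|] into
    the value of [psi] at one function bounded by [1]. *)
Lemma wuc_unit_sum (x : nat -> Omega -> K) : (forall n, C0 (x n)) ->
  (forall N w, \sum_(n < N) nrm (x n w) <= 1) -> wuc_unit x.
Proof.
move=> Cx x1; split=> // psi [psil _] psi1 N.
have [f [Cf fN fE]] : exists f, [/\ C0 f,
    forall w, nrm (f w) <= \sum_(n < N) nrm (x n w) &
    re (psi f) = \sum_(n < N) nrm (psi (x n))].
  elim: N => [|N [f [Cf fN fE]]].
    exists (fun=> 0); split; first exact: (C0_zero S).
      by move=> w; rewrite big_ord0 nrm0.
    by rewrite big_ord0 (lin0 S) // re0.
  have [t t1 tx] := lin_phase S psil (Cx N); have Ctx := C0_scale S t (Cx N).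
  exists (fun w => f w + t * x N w); split; first exact: (C0D S).
    move=> w; rewrite big_ord_recr /=; apply: le_trans (nrmD S _ _) _.
    by rewrite nrm_phase // lerD2r.
  by rewrite linD // reD tx fE big_ord_recr.
rewrite (eq_bigr (fun n : 'I_N => ofR (nrm (psi (x n))))); last first.
  by move=> n _; exact: normE.
rewrite -rmorph_sum -fE -(rmorph1 ofR) ofR_le.
apply: le_trans (ler_norm _) (le_trans (re_le_nrm S _) _).
rewrite -(rmorph1 ofR) in psi1; move/dnorm_leP in psi1.
have := psi1 f 1 Cf ler01; rewrite mulr1; apply => w.
exact: le_trans (fN w) (x1 N w).
Qed.

(* If no [lam] works, the pairs [(phi, f)] violating the bound for large [lam]
   form a filter. Along an ultrafilter refining it, let [b] be the limit of the
   measures [|phi|]. As [b] itself was allowed as [lam], one can choose the pairs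
   successively so that each [f_n] is small for [b], hence for all later [|phi|]. *)
Lemma domination (c d : R) : 0 <= c -> c < d ->
  (forall x : nat -> Omega -> K, wuc_unit x -> forall e, 0 < e ->
     exists N, forall n, (N <= n)%N -> forall phi, A phi -> nrm (phi (x n)) <= c + e) ->
  exists2 lam, positive_functional lam &
    forall phi f t, A phi -> C0 f -> 0 <= t -> (forall w, nrm (f w) <= t) ->
      nrm (phi f) <= lam (fun w => nrm (f w)) + d * t.
Proof.
move=> c0 cd Auc; apply: contrapT => nodom.
pose D lam := [set pf : ((Omega -> K) -> K) * (Omega -> K) |
  [/\ A pf.1, C0 pf.2, forall w, nrm (pf.2 w) <= 1 &
      lam (fun w => nrm (pf.2 w)) + d < nrm (pf.1 pf.2)]].
have D0 lam : positive_functional lam -> D lam !=set0.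
  move=> lamP; apply: contrapT => nD; apply: nodom; exists lam => // phi f t Aphi Cf t0 ft.
  rewrite leNgt; apply/negP => hlt; apply: nD.
  move: t0; rewrite le_eqVlt => /predU1P[t0|t0].
    subst t; have := AM Aphi Cf (lexx 0) ft.
    by have := lam_ge0 lamP (cone_nrm S Cf); rewrite !mulr0 in hlt *; lra.
  have nt : nrm (ofR t^-1) = t^-1 by rewrite nrm_ofR ?invr_ge0 ?ltW.
  exists (phi, fun w => ofR t^-1 * f w); split=> //=; first exact: (C0_scale S).
    by move=> w; rewrite nrmM nt ler_pdivrMl // mulr1.
  rewrite (linZ S) ?nrmM ?nt //; last exact: Alin.
  rewrite (_ : (fun w => _) = fun w => t^-1 * nrm (f w)); last first.
    by apply/funext => w; rewrite nrmM nt.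
  rewrite lamZ ?invr_ge0 ?(ltW t0) //; last exact: cone_nrm.
  by rewrite -(ltr_pM2l t0) mulrDr !mulrA divff ?gt_eqF // !mul1r mulrC mulrC [t * d]mulrC.
pose F := [set P | exists2 lam, positive_functional lam & D lam `<=` P].
have FF : ProperFilter F.
  apply: Build_ProperFilter_ex.
    by move=> P [lam /D0[pf Dpf] DP]; exists pf; exact: DP.
  split.
  - by exists (fun=> 0) => //; exact: positive_functional0.
  - move=> P Q [lam lamP DP] [mu muP DQ].
    (* A pair violating the bound for [lam + mu] violates it for each summand, the other being
       nonnegative. *)
    exists (fun u => lam u + mu u) => [|pf [Apf Cpf pf1 h]]; first exact: positive_functionalD.
    have := lam_ge0 lamP (cone_nrm S Cpf); have := lam_ge0 muP (cone_nrm S Cpf).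
    by split; [apply: DP|apply: DQ]; split=> //; lra.
  - by move=> P Q PQ [lam lamP DP]; exists lam => //; exact: subset_trans PQ.
have [G [GU FG]] := ultraFilterLemma FF.
have [|b bP bnear] := @positive_functional_ultra_limit R Omega _ G
    (fun pf => variation S pf.1) M GU M0.
  apply: FG; exists (fun=> 0); first exact: positive_functional0.
  move=> pf [/= Apf _ _ _]; split; first exact: variation_positive (Alin Apf) M0 (AM Apf).
  move=> u s cu s0 us; apply: (variation_le (AM Apf)) => // f Cf fu.
  by apply: AM => // w; exact: le_trans (us w).
(* The sequence built below has terms of size above [d - eps], while [uc] allows at most [c + eps]
   in the end; a third of the gap separates the two. *)
pose eps := (d - c) / 3; have eps0 : 0 < eps by rewrite divr_gt0 // subr_gt0.
(* [u] stands for the sum of the moduli of the functions chosen so far. *)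
pose good u := [/\ cone u, forall w, u w <= 1 & b u < eps].
have step u : exists f, good u -> [/\ C0 f, good (fun w => u w + nrm (f w)) &
    exists2 phi, A phi & d - eps < nrm (phi f)].
  have [gu|] := pselect (good u); last by exists (fun=> 0).
  have [cu u1 bu] := gu.
  (* A pair violating the bound for [N * b] satisfies [N * b |y| < M], which by this choice of [N]
     forces [b |y| < eps - b u]. *)
  pose N := M / (eps - b u); have bu' : 0 < eps - b u by rewrite subr_gt0.
  have N0 : 0 <= N by rewrite divr_ge0 // ltW.
  have GD : G (D (fun v => N * b v)).
    by apply: FG; exists (fun v => N * b v) => //; exact: positive_functionalZ.
  have [[phi y] [/= [/= Aphi Cy y1 hy] Vu]] := filter_ex (filterI GD (bnear u cu _ bu')).
  have Vu' : variation S phi u < eps by move: Vu; rewrite ltr_norml; lra.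
  have cy := cone_nrm S Cy.
  have Ny : N * b (fun w => nrm (y w)) < M.
    by have := AM Aphi Cy ler01 y1; rewrite mulr1; lra.
  have by_lt : b (fun w => nrm (y w)) < eps - b u.
    move: Ny; rewrite /N mulrAC ltr_pdivrMr // => Ny.
    have Mgt0 : 0 < M.
      rewrite lt_neqAle M0 andbT; apply/eqP => M00.
      by move: Ny; rewrite -M00 !mul0r ltxx.
    by rewrite -(ltr_pM2l Mgt0).
  have Cuy : C0 (fun w => ofR (u w) * y w).
    apply: C0_mul_continuous => //; first exact: (C0_continuous (real_scalars R) cu.1).
    by move=> w; rewrite cu.2 u1.
  (* The factor [1 - u] keeps [u + |f|] below [1]. The part removed satisfies [|u y| <= u], so it
     changes the value of [phi] by at most the variation of [phi] at [u], which is less than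
     [eps]. *)
  pose f w := y w - ofR (u w) * y w.
  have Cf : C0 f.
    rewrite (_ : f = fun w => -1 * (ofR (u w) * y w) + y w); first exact: (C0_lin S).
    by apply/funext => w; rewrite /f mulN1r addrC.
  have nf w : nrm (f w) = (1 - u w) * nrm (y w).
    have -> : f w = ofR (1 - u w) * y w by rewrite rmorphB rmorph1 mulrBl mul1r.
    by rewrite nrmM nrm_ofR // subr_ge0.
  exists f => _; split=> //.
    split.
    - by apply: coneD => //; exact: cone_nrm.
    - move=> w; rewrite nf; have := y1 w; have := u1 w; have := nrm_ge0 S (y w).
      by nra.
    - rewrite lamD //; last exact: cone_nrm.
      have : b (fun w => nrm (f w)) <= b (fun w => nrm (y w)).
        apply: lam_mono => // [|w]; first exact: cone_nrm.
        by rewrite nf; have := cu.2 w; have := nrm_ge0 S (y w); nra.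
      by lra.
  exists phi => //; rewrite (linB (Alin Aphi)) //.
  have := nrmD S (phi y - phi (fun w => ofR (u w) * y w)) (phi (fun w => ofR (u w) * y w)).
  rewrite subrK; have : nrm (phi (fun w => ofR (u w) * y w)) <= variation S phi u.
    apply: (variation_ge (AM Aphi)) => // w.
    by rewrite nrmM nrm_ofR ?cu.2 // ler_piMr ?cu.2.
  have := lam_ge0 bP cy; have := mulr_ge0 N0 (lam_ge0 bP cy).
  by lra.
have [next nextP] := choice step.
pose st := fix st n : Omega -> R :=
  if n is n'.+1 then fun w => st n' w + nrm (next (st n') w) else fun=> 0.
have good_st n : good (st n).
  elim: n => [|n /nextP[_ gn _]] //; split=> //; first exact: cone0.
  by rewrite lam0.
pose x n := next (st n).
have xwuc : wuc_unit x.
  apply: wuc_unit_sum => [n|N w]; first by have [] := nextP _ (good_st n).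
  have [_ st1 _] := good_st N; apply: le_trans (st1 w).
  rewrite le_eqVlt; apply/orP; left; apply/eqP.
  by elim: N {st1} => [|N IH]; rewrite ?big_ord0 // big_ord_recr /= IH.
have [N /(_ N (leqnn N)) AN] := Auc x xwuc eps eps0.
have [_ _ [phi Aphi hphi]] := nextP _ (good_st N).
have := AN phi Aphi; rewrite -/(x N) in hphi; rewrite /eps in hphi *.
by lra.
Qed.

End Domination.

(** * Operators *)

Section Operators.
Variables (R : realType) (K : numFieldType) (S : scalars R K).
Variable Omega : topologicalType.
Local Notation ofR := (ofR S).
Local Notation nrm := (nrm S).
Implicit Types (phi psi : (Omega -> K) -> K) (f g : Omega -> K).

Section Adjoint.
Variables (Y : normedModType K) (T : (Omega -> K) -> Y) (c : K).
Hypotheses (Tb : bounded_op T) (Tuc : uc_le T c).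

(** The zero series gives [0 <= c + e] for all [e > 0]. As [K] may be complex, [c] is first shown to
    be real, with [e = 1]; then [e = - c / 2] excludes [c < 0]. *)
Lemma uc_le_ge0 : 0 <= c.
Proof.
have xwuc : wuc_unit (fun (_ : nat) (_ : Omega) => 0 : K).
  apply: (wuc_unit_sum (S := S)) => [n|N w]; first exact: (C0_zero S).
  by rewrite big1 ?ler01 // => n _; rewrite nrm0.
have ce e : 0 < e -> 0 <= c + e.
  by move=> /(Tuc xwuc)[N /(_ N N (leqnn N) (leqnn N))]; rewrite subrr normr0.
have creal : c \is Num.real.
  by rewrite -[c](addrK 1) rpredB ?rpred1 // ger0_real // ce.
rewrite real_leNgt ?rpred0 //; apply/negP => c0.
have := ce (- c / 2); rewrite divr_gt0 ?oppr_gt0 // => /(_ isT).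
rewrite (_ : c + - c / 2 = c / 2); last by field.
by rewrite pmulr_lge0 ?invr_gt0 // => /(lt_le_trans c0); rewrite ltxx.
Qed.

Lemma adjoint_lin phi : adj_ball_image T phi -> lin_on_C0 phi.
Proof.
by move=> [g [gl _] ->] a f1 f2 Cf1 Cf2; rewrite Tb.1 // gl.
Qed.

Lemma adjoint_bounded : exists2 M, 0 <= M &
  forall phi, adj_ball_image T phi -> bounded_by S phi M.
Proof.
have [_ [M TM]] := Tb.
have M0 : 0 <= M.
  have := TM (fun=> 0) 1 (C0_zero S Omega); rewrite mulr1 => h.
  by apply: le_trans (h _); rewrite ?normr_ge0 //; split=> // w; rewrite normr0.
exists (nrm M) => [|phi [g [_ gb] ->]]; first exact: nrm_ge0.
apply/dnorm_leP => f t Cf ft; rewrite -ge0_ofR //.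
exact: le_trans (gb _) (TM f t Cf ft).
Qed.

Lemma adjoint_split e : 0 < e -> exists2 lam, positive_functional lam &
  forall phi, adj_ball_image T phi ->
    exists2 psi, order_interval S lam psi &
      bounded_by S (fun f => phi f - psi f) (nrm c + e).
Proof.
move=> e0; have c0 := uc_le_ge0; have [M M0 AM] := adjoint_bounded.
have nc0 := nrm_ge0 S c.
have cd : nrm c < nrm c + e by rewrite ltrDl.
have [|lam lamP lamA] := domination adjoint_lin M0 AM nc0 cd.
  move=> x xwuc eps eps0.
  have eps0' : 0 < ofR eps by rewrite ofR_gt0.
  (* Partial sum number [n] includes the term [x n], so [T (x n.+1)] is the difference of those
     numbered [n.+1] and [n]; hence the shift to [N.+1]. *)
  have [N TN] := Tuc xwuc eps0'; exists N.+1 => -[//|n] Nn phi [g [_ gb] ->].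
  rewrite -norm_le_ofR rmorphD -ge0_ofR //; apply: le_trans (gb _) _.
  have := TN n.+1 n (leqW Nn) Nn.
  by rewrite big_ord_recr /= addrAC subrr add0r.
exists lam => // phi Aphi; apply: order_interval_split => //.
- exact: addr_ge0 (ltW e0).
- exact: adjoint_lin.
- by move=> f t Cf t0 ft; exact: lamA.
Qed.

Lemma uc_le_omega_le : omega_le (adj_ball_image T) c.
Proof.
move=> e e0; have c0 := uc_le_ge0.
have [lam lamP lamA] := adjoint_split (nrm_gt0 S e0).
exists (order_interval S lam); split.
- by exists (fun=> 0); exact: order_interval0.
- exact: order_interval_wcompact.
- move=> phi /lamA[psi ipsi hpsi]; exists psi => //.
  by rewrite (ge0_ofR S c0) (ge0_ofR S (ltW e0)) -rmorphD; apply/dnorm_leP.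
Qed.

End Adjoint.

(** * Exchange of iterated limits along an ultrafilter *)

Section IteratedLimits.
Variables (T : Type) (G : set_system T).
Hypothesis GU : UltraFilter G.

Definition ultra_lim (u : T -> K) (l : K) : Prop :=
  forall e, 0 < e -> G [set t | nrm (u t - l) < e].

Lemma cvg_ultra_lim u l : u @ G --> l -> ultra_lim u l.
Proof.
move=> ul e e0; have e0' : 0 < ofR e by rewrite ofR_gt0.
by have /cvgrPdist_lt/(_ _ e0') := ul; apply: filterS => t; rewrite norm_lt_ofR nrmBC.
Qed.

Lemma ultra_lim_dist u v l m d : ultra_lim u l -> ultra_lim v m ->
  G [set t | nrm (u t - v t) <= d] -> nrm (l - m) <= d.
Proof.
move=> ul vm uv; apply/ler_addgt0Pr => e e0.
have e20 : 0 < e / 2 by rewrite divr_gt0.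
have [t [[/= h1 h2] h3]] := filter_ex (filterI (filterI (ul _ e20) (vm _ e20)) uv).
have := nrmB S ((u t - v t) + (v t - m)) (u t - l); have := nrmD S (u t - v t) (v t - m).
by rewrite (_ : _ - (u t - l) = l - m); [lra|ring].
Qed.

(** The weak-star limit in the bidual of a family in the unit ball of [C_0]. *)
Lemma bidual_of_ultrafilter (f : T -> Omega -> K) :
  (forall t, C0 (f t) /\ forall w, nrm (f t w) <= 1) ->
  exists2 Phi, is_bidual Phi &
    forall phi, is_dual phi -> ultra_lim (fun t => phi (f t)) (Phi phi).
Proof.
move=> fP; have lim_ex phi : exists l : K, is_dual phi -> phi (f t) @[t --> G] --> l.
  have [/(is_dualP S)[phil [s s0 phis]]|nphi] := pselect (is_dual phi); last by exists 0.
  have [|l phil'] := @ultra_bounded_cvg_scalar R K S T G (fun t => phi (f t)) s GU.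
    apply: filterE => t /=; have [Cf f1] := fP t.
    by have := phis _ _ Cf ler01 f1; rewrite mulr1.
  by exists l.
have [Phi PhiP] := choice lim_ex.
exists Phi => [|phi dphi]; last exact: cvg_ultra_lim (PhiP phi dphi).
split=> [a phi psi dphi dpsi|].
  have dsum : is_dual (fun g => a * phi g + psi g).
    have /(is_dualP S)[phil [s s0 phis]] := dphi.
    have /(is_dualP S)[psil [s' s'0 psis]] := dpsi.
    apply/(is_dualP S); split=> [b g1 g2 Cg1 Cg2|].
      by rewrite phil // psil //; ring.
    exists (nrm a * s + s') => [|g t Cg t0 gt].
      by rewrite addr_ge0 // mulr_ge0 // nrm_ge0.
    apply: le_trans (nrmD S _ _) _; rewrite nrmM mulrDl -mulrA lerD ?psis //.
    by rewrite ler_wpM2l ?nrm_ge0 // phis.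
  apply: (cvg_unique _ (PhiP _ dsum)) => //.
  exact: cvgD (cvgMr (PhiP _ dphi)) (PhiP _ dpsi).
exists 1 => phi s dphi s0 phis; rewrite mul1r (ge0_ofR S s0) norm_le_ofR.
have z : ultra_lim (fun=> 0) 0.
  by move=> e e0; apply: filterE => t /=; rewrite subrr nrm0.
rewrite -[Phi phi]subr0; apply: ultra_lim_dist (cvg_ultra_lim (PhiP phi dphi)) z _.
apply: filterE => t /=; rewrite subr0; have [Cf f1] := fP t.
rewrite (ge0_ofR S s0) in phis; move/dnorm_leP in phis.
by have := phis _ _ Cf ler01 f1; rewrite mulr1.
Qed.

End IteratedLimits.

(** Each [g m] composed with [T] is replaced by some [psi m] in the interval, at cost
    [nrm c + e / 2]. With [chi] the limit of the [psi m] and [Phi] that of the [f n], both [a] and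
    [b] are within this cost of [Phi chi]. *)
Lemma uc_le_gamma_le (Y : normedModType K) (T : (Omega -> K) -> Y) (c : K) :
  bounded_op T -> uc_le T c -> gamma_le T (2 * c).
Proof.
move=> Tb Tuc f g r q a b fP gP rP ra qP qb; have c0 := uc_le_ge0 Tuc.
rewrite (_ : 2 * c = ofR (2 * nrm c)) ?norm_le_ofR; last first.
  by rewrite rmorphM rmorph_nat -ge0_ofR.
apply/ler_addgt0Pr => e e0; have e20 : 0 < e / 2 by rewrite divr_gt0.
have [lam lamP lamA] := adjoint_split Tb Tuc e20.
have psi_ex m : exists psi, order_interval S lam psi /\
    bounded_by S (fun h => g m (T h) - psi h) (nrm c + e / 2).
  have [|psi ipsi hpsi] := lamA (fun h => g m (T h)); last by exists psi.
  by exists (g m).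
have [psi psiP] := choice psi_ex.
have [G [GU Goo]] := ultraFilterLemma eventually_filter.
have cvgG u l : cvgK u l -> ultra_lim G u l.
  move=> ul eps eps0; have eps0' : 0 < ofR eps by rewrite ofR_gt0.
  have [N uN] := ul _ eps0'; apply: Goo; exists N => // n /= Nn.
  by rewrite -norm_lt_ofR uN.
have fP' n : C0 (f n) /\ forall w, nrm (f n w) <= 1.
  have [Cf [_ f1]] := fP n; split=> // w.
  by have := f1 w; rewrite -(rmorph1 ofR) norm_le_ofR.
have close m n : nrm (g m (T (f n)) - psi m (f n)) <= nrm c + e / 2.
  have [Cf f1] := fP' n; have [_ h] := psiP m.
  by have := h _ _ Cf ler01 f1; rewrite mulr1.
have [|chi ichi chiP] := order_interval_ultra_limit (S := S) (lam := lam) (F := psi) GU.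
  by apply: filterE => m; exact: (psiP m).1.
have [Phi PhiP PhiG] := bidual_of_ultrafilter GU fP'.
have hr n : nrm (r n - chi (f n)) <= nrm c + e / 2.
  apply: (ultra_lim_dist GU (cvgG _ _ (rP n)) (chiP _ (fP' n).1)).
  by apply: filterE => m; exact: close.
have hq m : nrm (q m - Phi (psi m)) <= nrm c + e / 2.
  apply: (ultra_lim_dist GU (cvgG _ _ (qP m))).
    exact: PhiG (order_interval_dual lamP (psiP m).1).
  by apply: filterE => n; exact: close.
(* This is the actual exchange of limits: [psi m] tends to [chi] only on [C_0], and [Phi] is
   continuous along it because the interval contains all these functionals. *)
have Phichi : ultra_lim G (fun m => Phi (psi m)) (Phi chi).
  move=> eps eps0; have eps3 : 0 < eps / 3 by rewrite divr_gt0.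
  have [h Ch hP] := bidual_approx S lamP PhiP eps3.
  apply: filterS (chiP h Ch _ eps3) => m /= hm.
  have := hP _ (psiP m).1; have := hP _ ichi.
  have := nrmB S ((Phi (psi m) - psi m h) + (psi m h - chi h)) (Phi chi - chi h).
  have := nrmD S (Phi (psi m) - psi m h) (psi m h - chi h).
  rewrite (_ : _ - (Phi chi - chi h) = Phi (psi m) - Phi chi); last by ring.
  by lra.
have ha : nrm (a - Phi chi) <= nrm c + e / 2.
  apply: (ultra_lim_dist GU (cvgG _ _ ra) (PhiG _ (order_interval_dual lamP ichi))).
  by apply: filterE => n; exact: hr.
have hb : nrm (b - Phi chi) <= nrm c + e / 2.
  apply: (ultra_lim_dist GU (cvgG _ _ qb) Phichi).
  by apply: filterE => m; exact: hq.
have := nrmB S (a - Phi chi) (b - Phi chi).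
by rewrite (_ : _ - (b - Phi chi) = a - b); [lra|ring].
Qed.

Lemma omega_le_weaken (A : set ((Omega -> K) -> K)) (c d : K) :
  c <= d -> omega_le A c -> omega_le A d.
Proof.
move=> cd Ac e e0; have [Ks [K0 Kc KA]] := Ac e e0; exists Ks; split=> // phi /KA[k Kk hk].
exists k => // f t Cf ft; apply: le_trans (hk f t Cf ft) _.
by rewrite ler_wpM2r ?lerD2r //; exact: ft.1.
Qed.

Lemma C0_Vq : has_Vq K Omega.
Proof. by exists 2 => // Y T Tb c Tuc; exact: uc_le_gamma_le. Qed.

Lemma C0_Vq_wstar : has_Vq_wstar K Omega.
Proof. by exists 1 => // Y T Tb c Tuc; rewrite mul1r; exact: uc_le_omega_le. Qed.

End Operators.

Theorem theorem4p1 :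
  (forall (R : realType) (Omega : topologicalType),
     hausdorff_space Omega -> locally_compact [set: Omega] ->
     [/\ (forall (Y : completeNormedModType R[i]) (T : (Omega -> R[i]) -> Y),
            bounded_op T -> forall c : R[i], uc_le T c ->
            omega_le (adj_ball_image T) (real_complex R pi * c)),
         has_Vq R[i] Omega &
         has_Vq_wstar R[i] Omega]) /\
  (forall (R : realType) (Omega : topologicalType),
     hausdorff_space Omega -> locally_compact [set: Omega] ->
     [/\ (forall (Y : completeNormedModType R) (T : (Omega -> R) -> Y),
            bounded_op T -> forall c : R, uc_le T c ->
            omega_le (adj_ball_image T) (2 * c)),
         has_Vq R Omega &
         has_Vq_wstar R Omega]).
Proof.
split=> R Omega _ _; split.
- move=> Y T Tb c Tuc; apply: omega_le_weaken (uc_le_omega_le (complex_scalars R) Tb Tuc).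
  rewrite ler_peMl ?(uc_le_ge0 (complex_scalars R) Tuc) //.
  by rewrite -(rmorph1 (real_complex R)) lecR (le_trans _ (pi_ge2 R)) // ler1n.
- exact: C0_Vq (complex_scalars R) Omega.
- exact: C0_Vq_wstar (complex_scalars R) Omega.
- move=> Y T Tb c Tuc; apply: omega_le_weaken (uc_le_omega_le (real_scalars R) Tb Tuc).
  by rewrite ler_peMl ?(uc_le_ge0 (real_scalars R) Tuc) // ler1n.
- exact: C0_Vq (real_scalars R) Omega.
- exact: C0_Vq_wstar (real_scalars R) Omega.
Qed.
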